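(* The map $\phi:G\to\Pi_{G_n}K_n$ is a homeomorphism, and $G$ is topologically complete (i.e. its topology is induced by some complete metric). Here $\Pi_{G_n}K_n$ carries the product topology with each $K_n$ discrete.
   Context: Spaces of continuous functions carry the compact-open topology and quotients the quotient topology. Let $Z^+=\{(n,0)\in\mathbb R^2: n=1,2,3,\dots\}$ (discrete) and let $X=I(Z^+,\mathbb R^2)$ be the space of all one-to-one functions $Z^+\to\mathbb R^2$. Let $G=\pi_1(X,\mathrm{id}_{Z^+})$ be the fundamental group (product = concatenation, first factor first), with the quotient topology from the space of loops $[0,1]\to X$ based at $\mathrm{id}_{Z^+}$ (the topological fundamental group). For $n\ge1$ let $X_n=\{f\in X : f(i,0)=(i,0)\text{ for all } i>n,\ \text{and } f(i,0)\in(-\infty,n+2/3]\times\mathbb R\text{ for all } i\le n\}$. Define $R_n:X\to[0,\infty)$ by $R_n(g)=\min\{r\ge0 : g(i,0)\in(-\infty,n+2/3+r]\times\mathbb R \text{ for all } i\le n\}$ and the retraction $P_n:X\to X_n$ by $P_n(g)(i,0)=g(i,0)-(R_n(g),0)$ for $i\le n$ and $P_n(g)(i,0)=(i,0)$ for $i>n$. Let $P_n^*:\pi_1(X,\mathrm{id})\to\pi_1(X_n,\mathrm{id})$ and $i_n^*:\pi_1(X_n,\mathrm{id})\to\pi_1(X,\mathrm{id})$ be induced by $P_n$ and by inclusion. Put $G_n=\operatorname{im}(i_n^* )\subset G$ and $\phi_n=i_n^*P_n^*:G\to G_n$ for $n\ge1$; put $G_0=\{[\mathrm{id}]\}$ and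 let $\phi_0:G\to G_0$ be the trivial map. Let $K_n=G_n\cap\ker\phi_{n-1}$ for $n\ge1$. $\Pi_{G_n}K_n$ (the twisted product) is the set $\prod_{n=1}^\infty K_n$ with the group operation $[(x_1,x_2,\dots)*(y_1,y_2,\dots)]_n=(y_1\cdots y_{n-1})^{-1}x_n(y_1\cdots y_{n-1})y_n$, multiplication being performed in $G_n$. The homomorphism $\phi:G\to\Pi_{G_n}K_n$ is defined by $(\phi(g))_n=(\phi_{n-1}(g))^{-1}\phi_n(g)$. *)

(* Defs.v *)
From HB Require Import structures.
From mathcomp Require Import all_boot all_order all_algebra.
From mathcomp Require Import all_classical all_reals topology normedtype.
From mathcomp Require Import homotopy generic_quotient lra.
Set Implicit Arguments.
Unset Strict Implicit.
Unset Printing Implicit Defensive.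

Import Order.TTheory GRing.Theory Num.Theory.
Import numFieldNormedType.Exports.

Local Open Scope classical_set_scope.
Local Open Scope ring_scope.

Definition insub_set T (A : set T) (x : T) (Ax : A x) : A :=
  @exist T (fun y => y \in A) x (mem_set Ax).

Definition unit_interval (R : realType) : Type := set_type (`[0%R : R, 1%R]%classic).

Section unit_interval.
Context {R : realType}.
Local Notation I := (unit_interval R).

HB.instance Definition _ := Topological.copy I (set_type (`[0%R : R, 1%R]%classic)).

Lemma clamp_subproof (r : R) :
  `[0%R : R, 1%R]%classic (Num.max 0 (Num.min 1 r)).
Proof. by rewrite /= in_itv /= le_max lexx /= ge_max ler01 ge_min lexx. Qed.

Definition clamp (r : R) : I := insub_set (clamp_subproof r).

Definition ival (t : I) : R := \val t.

Lemma ivalP (t : I) : 0 <= ival t <= 1.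
Proof. by have := set_mem (valP t); rewrite /= in_itv. Qed.

Lemma ival_inj : injective ival.
Proof. exact: val_inj. Qed.

Lemma clampE (r : R) : 0 <= r <= 1 -> ival (clamp r) = r.
Proof.
move=> /andP[r0 r1]; rewrite /ival /=.
by rewrite (min_idPr r1) (max_idPr r0).
Qed.

Lemma clamp_ge1 (r : R) : 1 <= r -> ival (clamp r) = 1.
Proof. by move=> r1; rewrite /ival /= (min_idPl r1) (max_idPr ler01). Qed.

Lemma clamp_le0 (r : R) : r <= 0 -> ival (clamp r) = 0.
Proof.
move=> r0; rewrite /ival /= (min_idPr (le_trans r0 ler01)).
by rewrite (max_idPl r0).
Qed.

Lemma ivalK : cancel ival clamp.
Proof. by move=> t; apply: ival_inj; rewrite clampE// ivalP. Qed.

Lemma ival_continuous : continuous ival.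
Proof. exact: initial_continuous. Qed.

Lemma clamp_continuous : continuous clamp.
Proof.
apply: continuous_comp_initial => r /=.
apply: (@continuous_max R); first exact: cst_continuous.
by apply: continuous_min; [exact: cst_continuous|].
Qed.

Let zero_neq_one : clamp 0 != clamp 1.
Proof.
apply/eqP => /(congr1 ival); rewrite !clampE ?lexx ?ler01// => /eqP.
by rewrite eq_sym oner_eq0.
Qed.

HB.instance Definition _ := isBiPointed.Build I zero_neq_one.

Lemma ival0 : ival zero = 0. Proof. by rewrite clampE// lexx ler01. Qed.
Lemma ival1 : ival one = 1. Proof. by rewrite clampE// lexx ler01. Qed.
End unit_interval.

Local Open Scope quotient_scope.

Lemma continuousT_comp (X Y Z : topologicalType) (g : Y -> Z) (f : X -> Y) :
  continuous g -> continuous f -> continuous (fun x => g (f x)).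
Proof. by move=> cg cf x; apply: continuous_comp; [exact: cf|exact: cg]. Qed.

Lemma continuousT_pair (X Y Z : topologicalType) (f : X -> Y) (g : X -> Z) :
  continuous f -> continuous g -> continuous (fun x => (f x, g x)).
Proof. by move=> cf cg x; apply: cvg_pair; [exact: cf|exact: cg]. Qed.

Lemma continuousT_fst (X Y : topologicalType) : continuous (@fst X Y).
Proof. by move=> z; exact: cvg_fst. Qed.

Lemma continuousT_snd (X Y : topologicalType) : continuous (@snd X Y).
Proof. by move=> z; exact: cvg_snd. Qed.

Section continuousT_real.
Context {R : realType} {Z : topologicalType}.
Implicit Types f g : Z -> R.

Lemma continuousT_cst (U : topologicalType) (c : U) :
  continuous (fun _ : Z => c).
Proof. by move=> z; exact: cvg_cst. Qed.

Lemma continuousT_D f g :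
  continuous f -> continuous g -> continuous (fun z => f z + g z).
Proof. by move=> cf cg z; apply: cvgD; [exact: cf|exact: cg]. Qed.

Lemma continuousT_B f g :
  continuous f -> continuous g -> continuous (fun z => f z - g z).
Proof. by move=> cf cg z; apply: cvgB; [exact: cf|exact: cg]. Qed.

Lemma continuousT_M f g :
  continuous f -> continuous g -> continuous (fun z => f z * g z).
Proof. by move=> cf cg z; apply: cvgM; [exact: cf|exact: cg]. Qed.

Lemma continuousT_max f g :
  continuous f -> continuous g -> continuous (fun z => Num.max (f z) (g z)).
Proof. by move=> cf cg z; apply: continuous_max; [exact: cf|exact: cg]. Qed.

Lemma continuousT_min f g :
  continuous f -> continuous g -> continuous (fun z => Num.min (f z) (g z)).
Proof. by move=> cf cg z; apply: continuous_min; [exact: cf|exact: cg]. Qed.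
End continuousT_real.

Section glue.
Context {R : realType} {Z T : topologicalType}.

Lemma glue_continuous (u : Z -> R) (c : R) (f g : Z -> T) :
  continuous u -> continuous f -> continuous g ->
  (forall z, u z = c -> f z = g z) ->
  continuous (fun z => if u z <= c then f z else g z).
Proof.
move=> cu cf cg fg z A /= nA.
have [uzc|uzc|uzc] := ltgtP (u z) c.
- rewrite (ltW uzc) in nA.
  have nf : nbhs z (f @^-1` A) by exact: cf.
  have nu : nbhs z (u @^-1` [set r | r < c]).
    by apply: cu; apply: open_nbhs_nbhs; split => //; exact: open_lt.
  by apply: filterS2 nf nu => w /= Aw uw; rewrite (ltW uw).
- rewrite leNgt uzc /= in nA.
  have ng : nbhs z (g @^-1` A) by exact: cg.
  have nu : nbhs z (u @^-1` [set r | c < r]).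
    by apply: cu; apply: open_nbhs_nbhs; split => //; exact: open_gt.
  by apply: filterS2 ng nu => w /= Aw uw; rewrite leNgt uw.
- rewrite uzc lexx in nA.
  have nf : nbhs z (f @^-1` A) by exact: cf.
  have ng : nbhs z (g @^-1` A) by apply: cg; rewrite -fg.
  by apply: filterS2 nf ng => w /= Aw Bw; case: ifP.
Qed.
End glue.

Section fundamental_group.
Context {R : realType} {T : topologicalType}.
Local Notation I := (unit_interval R).

(* Homotopy relative to the endpoints; the first coordinate of I * I is the
   homotopy parameter, the second one the path parameter. *)
Definition path_homotopic {x y : T} (p q : {path I from x to y in T}) : Prop :=
  exists H : I * I -> T,
    [/\ continuous H,
        (forall t, H (zero, t) = p t), (forall t, H (one, t) = q t),
        (forall s, H (s, zero) = x) & (forall s, H (s, one) = y)].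

Lemma path_homotopic_refl (x y : T) (p : {path I from x to y in T}) :
  path_homotopic p p.
Proof.
exists (p \o snd); split => //=.
- move=> z; apply: continuous_comp; [exact: cvg_snd|exact: cts_fun].
- by move=> _; exact: path_zero.
- by move=> _; exact: path_one.
Qed.

Let clamp_comp_continuous (Z : topologicalType) (u : Z -> R) :
  continuous u -> continuous (clamp \o u).
Proof.
by move=> cu z; apply: continuous_comp; [exact: cu|exact: clamp_continuous].
Qed.

Let fst_ival_continuous : continuous (fun z : I * I => ival z.1).
Proof.
by move=> z; apply: continuous_comp; [exact: cvg_fst|exact: ival_continuous].
Qed.

Let snd_ival_continuous : continuous (fun z : I * I => ival z.2).
Proof.
by move=> z; apply: continuous_comp; [exact: cvg_snd|exact: ival_continuous].
Qed.

Lemma path_homotopic_reparam (x y a b : T) (f : {path I from a to b in T})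
    (p q : {path I from x to y in T}) (u v : I -> R) :
  continuous u -> continuous v ->
  u zero = v zero -> u one = v one ->
  (forall t, p t = f (clamp (u t))) -> (forall t, q t = f (clamp (v t))) ->
  path_homotopic p q.
Proof.
move=> cu cv uv0 uv1 pE qE.
exists (fun z => f (clamp ((1 - ival z.1) * u z.2 + ival z.1 * v z.2))); split.
- apply: (continuousT_comp (@cts_fun _ _ f)).
  apply: (continuousT_comp clamp_continuous).
  have cu2 : continuous (fun z : I * I => u z.2).
    exact: (continuousT_comp cu (@continuousT_snd _ _)).
  have cv2 : continuous (fun z : I * I => v z.2).
    exact: (continuousT_comp cv (@continuousT_snd _ _)).
  apply: continuousT_D; apply: continuousT_M.
  - apply: continuousT_B; [exact: continuousT_cst|].
    exact: fst_ival_continuous.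
  - exact: cu2.
  - exact: fst_ival_continuous.
  - exact: cv2.
- by move=> t /=; rewrite ival0 subr0 mul1r mul0r addr0 pE.
- by move=> t /=; rewrite ival1 subrr mul1r mul0r add0r qE.
- move=> s /=; rewrite -uv0 -mulrDl subrK mul1r -pE; exact: path_zero.
- move=> s /=; rewrite -uv1 -mulrDl subrK mul1r -pE; exact: path_one.
Qed.

Lemma path_homotopic_sym (x y : T) (p q : {path I from x to y in T}) :
  path_homotopic p q -> path_homotopic q p.
Proof.
move=> [H [cH H0 H1 Hx Hy]].
exists (fun z => H (clamp (1 - ival z.1), z.2)); split.
- apply: (continuousT_comp cH).
  apply: continuousT_pair; last exact: continuousT_snd.
  apply: (continuousT_comp clamp_continuous).
  apply: continuousT_B; [exact: continuousT_cst|].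
  exact: fst_ival_continuous.
- by move=> t /=; rewrite ival0 subr0; exact: H1.
- by move=> t /=; rewrite ival1 subrr; exact: H0.
- by move=> s /=; exact: Hx.
- by move=> s /=; exact: Hy.
Qed.

Let two_continuous (Z : topologicalType) (u : Z -> R) :
  continuous u -> continuous (fun z => 2 * u z).
Proof.
move=> cu; apply: continuousT_M; [exact: continuousT_cst|exact: cu].
Qed.

Let two_sub_continuous (Z : topologicalType) (u : Z -> R) :
  continuous u -> continuous (fun z => 2 * u z - 1).
Proof.
move=> cu; apply: continuousT_B; [exact: two_continuous|].
exact: continuousT_cst.
Qed.

Lemma path_homotopic_trans (x y : T) (p q r : {path I from x to y in T}) :
  path_homotopic p q -> path_homotopic q r -> path_homotopic p r.
Proof.
move=> [H [cH H0 H1 Hx Hy]] [K [cK K0 K1 Kx Ky]].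
exists (fun z => if ival z.1 <= 2^-1 then H (clamp (2 * ival z.1), z.2)
                 else K (clamp (2 * ival z.1 - 1), z.2)); split.
- apply: glue_continuous => //.
  + apply: (continuousT_comp cH).
    apply: continuousT_pair; last exact: continuousT_snd.
    by apply: (clamp_comp_continuous _) => {}z; exact: two_continuous.
  + apply: (continuousT_comp cK).
    apply: continuousT_pair; last exact: continuousT_snd.
    by apply: (clamp_comp_continuous _) => {}z; exact: two_sub_continuous.
  + move=> [s t] /= ->; rewrite divff ?pnatr_eq0// subrr.
    by rewrite (H1 t) (K0 t).
- move=> t /=; rewrite ival0 invr_ge0 ler0n mulr0; exact: H0.
- move=> t /=; rewrite ival1 ifF; last by apply/negbTE; rewrite -ltNge; lra.
  by rewrite mulr1 (_ : 2 - 1 = 1 :> R); [exact: K1|lra].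
- by move=> s /=; case: ifP => _; [exact: Hx|exact: Kx].
- by move=> s /=; case: ifP => _; [exact: Hy|exact: Ky].
Qed.

Section concatenation.
Context {x : T}.
Local Notation loop := {path I from x to x in T}.
Implicit Types p q r : loop.

Let loop_zero p : p (clamp 0) = x. Proof. exact: path_zero. Qed.
Let loop_one p : p (clamp 1) = x. Proof. exact: path_one. Qed.

Definition concat_fun p q (t : I) : T :=
  if ival t <= 2^-1 then p (clamp (2 * ival t))
  else q (clamp (2 * ival t - 1)).

Let concat_fun_continuous p q : continuous (concat_fun p q).
Proof.
apply: glue_continuous; first exact: ival_continuous.
- apply: (continuousT_comp (@cts_fun _ _ p)).
  apply: (continuousT_comp clamp_continuous).
  by apply: two_continuous; exact: ival_continuous.
- apply: (continuousT_comp (@cts_fun _ _ q)).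
  apply: (continuousT_comp clamp_continuous).
  by apply: two_sub_continuous; exact: ival_continuous.
- move=> t ->; rewrite divff ?pnatr_eq0// subrr.
  by rewrite (loop_one p) (loop_zero q).
Qed.

Let concat_fun0 p q : concat_fun p q zero = x.
Proof.
rewrite /concat_fun ival0 invr_ge0 ler0n mulr0; exact: path_zero.
Qed.

Let concat_fun1 p q : concat_fun p q one = x.
Proof.
rewrite /concat_fun ival1 ifF; last by apply/negbTE; rewrite -ltNge; lra.
by rewrite mulr1 (_ : 2 - 1 = 1 :> R); [exact: path_one|lra].
Qed.

Definition concat p q : loop :=
  mk_path (@concat_fun_continuous p q) (concat_fun0 p q) (concat_fun1 p q).

Definition const_loop : loop := cst x.

Definition reverse_fun p (t : I) : T := p (clamp (1 - ival t)).

Let reverse_fun_continuous p : continuous (reverse_fun p).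
Proof.
apply: (continuousT_comp (@cts_fun _ _ p)).
apply: (continuousT_comp clamp_continuous).
apply: continuousT_B; [exact: continuousT_cst|exact: ival_continuous].
Qed.

Let reverse_fun0 p : reverse_fun p zero = x.
Proof. by rewrite /reverse_fun ival0 subr0; exact: path_one. Qed.

Let reverse_fun1 p : reverse_fun p one = x.
Proof. by rewrite /reverse_fun ival1 subrr; exact: path_zero. Qed.

Definition reverse p : loop :=
  mk_path (@reverse_fun_continuous p) (reverse_fun0 p) (reverse_fun1 p).

Lemma concatEl p q t :
  ival t <= 2^-1 -> concat p q t = p (clamp (2 * ival t)).
Proof. by move=> t2; rewrite -[LHS]/(concat_fun p q t) /concat_fun t2. Qed.

Lemma concatEr p q t :
  2^-1 <= ival t -> concat p q t = q (clamp (2 * ival t - 1)).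
Proof.
move=> t2; rewrite -[LHS]/(concat_fun p q t) /concat_fun.
case: ifPn => // t2'.
have -> : ival t = 2^-1 by apply/eqP; rewrite eq_le t2 t2'.
by rewrite divff ?pnatr_eq0// subrr (loop_one p) (loop_zero q).
Qed.

Lemma reverseE p t : reverse p t = p (clamp (1 - ival t)).
Proof. by []. Qed.

Lemma concat_homotopic p p' q q' : path_homotopic p p' ->
  path_homotopic q q' -> path_homotopic (concat p q) (concat p' q').
Proof.
move=> [H [cH H0 H1 Hx Hy]] [K [cK K0 K1 Kx Ky]].
exists (fun z => if ival z.2 <= 2^-1 then H (z.1, clamp (2 * ival z.2))
                 else K (z.1, clamp (2 * ival z.2 - 1))); split.
- apply: glue_continuous => //.
  + apply: (continuousT_comp cH).
    apply: continuousT_pair; first exact: continuousT_fst.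
    by apply: (clamp_comp_continuous _) => {}z; exact: two_continuous.
  + apply: (continuousT_comp cK).
    apply: continuousT_pair; first exact: continuousT_fst.
    by apply: (clamp_comp_continuous _) => {}z; exact: two_sub_continuous.
  + move=> [s t] /= ->; rewrite divff ?pnatr_eq0// subrr.
    by rewrite (Hy s) (Kx s).
- by move=> t /=; rewrite H0 K0.
- by move=> t /=; rewrite H1 K1.
- by move=> s /=; rewrite ival0 invr_ge0 ler0n mulr0; exact: Hx.
- move=> s /=; rewrite ival1 ifF; last by apply/negbTE; rewrite -ltNge; lra.
  by rewrite mulr1 (_ : 2 - 1 = 1 :> R); [exact: Ky|lra].
Qed.

Lemma reverse_homotopic p q :
  path_homotopic p q -> path_homotopic (reverse p) (reverse q).
Proof.
move=> [H [cH H0 H1 Hx Hy]].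
exists (fun z => H (z.1, clamp (1 - ival z.2))); split.
- apply: (continuousT_comp cH).
  apply: continuousT_pair; first exact: continuousT_fst.
  apply: (continuousT_comp clamp_continuous).
  apply: continuousT_B; [exact: continuousT_cst|].
  exact: snd_ival_continuous.
- by move=> t /=; exact: H0.
- by move=> t /=; exact: H1.
- by move=> s /=; rewrite ival0 subr0; exact: Hy.
- by move=> s /=; rewrite ival1 subrr; exact: Hx.
Qed.

Let ivalcE (r : R) : 0 <= r <= 1 -> ival (clamp r) = r.
Proof. exact: clampE. Qed.

Lemma concatA p q r :
  path_homotopic (concat p (concat q r)) (concat (concat p q) r).
Proof.
pose u (t : I) : R :=
  Num.max (2^-1 * ival t) (Num.max (ival t - 4^-1) (2 * ival t - 1)).
apply: (@path_homotopic_reparam _ _ _ _ (concat (concat p q) r) _ _ u ival).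
- apply: continuousT_max.
    apply: continuousT_M; [exact: continuousT_cst|exact: ival_continuous].
  apply: continuousT_max.
    by apply: continuousT_B; [exact: ival_continuous|exact: continuousT_cst].
  by apply: two_sub_continuous; exact: ival_continuous.
- exact: ival_continuous.
- rewrite /u ival0; apply/eqP; rewrite eq_le !ge_max !le_max; lra.
- rewrite /u ival1; apply/eqP; rewrite eq_le !ge_max !le_max; lra.
- move=> t; have /andP[t0 t1] := ivalP t.
  have [t2|t2] := leP (ival t) 2^-1.
    have ut : u t = 2^-1 * ival t.
      by apply/eqP; rewrite eq_le !ge_max !le_max; lra.
    have v1 : ival (clamp (u t)) = 2^-1 * ival t by rewrite ut ivalcE//; lra.
    have v2 : ival (clamp (2 * ival (clamp (u t)))) = ival t.
      by rewrite v1 ivalcE; lra.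
    rewrite concatEl// concatEl; last by rewrite v1; lra.
    by rewrite concatEl v2.
  have [t3|t3] := leP (ival t) (3/4).
    have ut : u t = ival t - 4^-1.
      by apply/eqP; rewrite eq_le !ge_max !le_max; lra.
    have v1 : ival (clamp (u t)) = ival t - 4^-1 by rewrite ut ivalcE//; lra.
    have v2 : ival (clamp (2 * ival (clamp (u t)))) = 2 * ival t - 2^-1.
      by rewrite v1 ivalcE; lra.
    have v3 : ival (clamp (2 * ival t - 1)) = 2 * ival t - 1.
      by rewrite ivalcE; lra.
    rewrite concatEr ?(ltW t2)// concatEl; last by rewrite v3; lra.
    rewrite concatEl; last by rewrite v1; lra.
    rewrite concatEr; last by rewrite v2; lra.
    by congr (q (clamp _)); rewrite v2 v3; lra.
  have ut : u t = 2 * ival t - 1.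
    by apply/eqP; rewrite eq_le !ge_max !le_max; lra.
  have v1 : ival (clamp (u t)) = 2 * ival t - 1 by rewrite ut ivalcE//; lra.
  have v3 : ival (clamp (2 * ival t - 1)) = 2 * ival t - 1.
    by rewrite ivalcE; lra.
  rewrite concatEr ?(ltW t2)// concatEr; last by rewrite v3; lra.
  by rewrite concatEr v1 ?v3//; lra.
- by move=> t; rewrite ivalK.
Qed.

Lemma concat1l p : path_homotopic (concat const_loop p) p.
Proof.
apply: (@path_homotopic_reparam _ _ _ _ p _ _
  (fun t => Num.max 0 (2 * ival t - 1)) ival).
- apply: continuousT_max; first exact: continuousT_cst.
  by apply: two_sub_continuous; exact: ival_continuous.
- exact: ival_continuous.
- by rewrite ival0; apply/eqP; rewrite eq_le !ge_max !le_max; lra.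
- by rewrite ival1; apply/eqP; rewrite eq_le !ge_max !le_max; lra.
- move=> t; have /andP[t0 t1] := ivalP t.
  have [t2|t2] := leP (ival t) 2^-1.
    rewrite concatEl// (_ : Num.max _ _ = 0); first by rewrite (loop_zero p).
    by apply/eqP; rewrite eq_le !ge_max !le_max; lra.
  rewrite concatEr ?(ltW t2)//; congr (p (clamp _)).
  by apply/eqP; rewrite eq_le !ge_max !le_max; lra.
- by move=> t; rewrite ivalK.
Qed.

Lemma concat1r p : path_homotopic (concat p const_loop) p.
Proof.
apply: (@path_homotopic_reparam _ _ _ _ p _ _
  (fun t => Num.min 1 (2 * ival t)) ival).
- apply: continuousT_min; first exact: continuousT_cst.
  by apply: two_continuous; exact: ival_continuous.
- exact: ival_continuous.
- by rewrite ival0; apply/eqP; rewrite eq_le !ge_min !le_min; lra.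
- by rewrite ival1; apply/eqP; rewrite eq_le !ge_min !le_min; lra.
- move=> t; have /andP[t0 t1] := ivalP t.
  have [t2|t2] := leP (ival t) 2^-1.
    rewrite concatEl//; congr (p (clamp _)).
    by apply/eqP; rewrite eq_le !ge_min !le_min; lra.
  rewrite concatEr ?(ltW t2)// (_ : Num.min _ _ = 1).
    by rewrite (loop_one p).
  by apply/eqP; rewrite eq_le !ge_min !le_min; lra.
- by move=> t; rewrite ivalK.
Qed.

Lemma concatVl p : path_homotopic (concat (reverse p) p) const_loop.
Proof.
apply: (@path_homotopic_reparam _ _ _ _ p _ _
  (fun t => Num.max (1 - 2 * ival t) (2 * ival t - 1)) (cst 1)).
- apply: continuousT_max.
    apply: continuousT_B; first exact: continuousT_cst.
    by apply: two_continuous; exact: ival_continuous.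
  by apply: two_sub_continuous; exact: ival_continuous.
- exact: continuousT_cst.
- by rewrite ival0; apply/eqP; rewrite eq_le !ge_max !le_max /cst; lra.
- by rewrite ival1; apply/eqP; rewrite eq_le !ge_max !le_max /cst; lra.
- move=> t; have /andP[t0 t1] := ivalP t.
  have [t2|t2] := leP (ival t) 2^-1.
    rewrite concatEl// reverseE ivalcE; last lra.
    congr (p (clamp _)).
    by apply/eqP; rewrite eq_le !ge_max !le_max; lra.
  rewrite concatEr ?(ltW t2)//; congr (p (clamp _)).
  by apply/eqP; rewrite eq_le !ge_max !le_max; lra.
- by move=> t; rewrite (loop_one p).
Qed.

Lemma concatVr p : path_homotopic (concat p (reverse p)) const_loop.
Proof.
apply: (@path_homotopic_reparam _ _ _ _ p _ _
  (fun t => Num.min (2 * ival t) (1 - (2 * ival t - 1))) (cst 0)).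
- apply: continuousT_min.
    by apply: two_continuous; exact: ival_continuous.
  apply: continuousT_B; first exact: continuousT_cst.
  by apply: two_sub_continuous; exact: ival_continuous.
- exact: continuousT_cst.
- by rewrite ival0; apply/eqP; rewrite eq_le !ge_min !le_min /cst; lra.
- by rewrite ival1; apply/eqP; rewrite eq_le !ge_min !le_min /cst; lra.
- move=> t; have /andP[t0 t1] := ivalP t.
  have [t2|t2] := leP (ival t) 2^-1.
    rewrite concatEl//; congr (p (clamp _)).
    by apply/eqP; rewrite eq_le !ge_min !le_min; lra.
  rewrite concatEr ?(ltW t2)// reverseE ivalcE; last lra.
  congr (p (clamp _)).
  by apply/eqP; rewrite eq_le !ge_min !le_min; lra.
- by move=> t; rewrite (loop_zero p).
Qed.

Definition homotopic_rel : rel loop := [rel p q | `[< path_homotopic p q >]].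

Let homotopic_rel_refl : reflexive homotopic_rel.
Proof. by move=> p; apply/asboolP; exact: path_homotopic_refl. Qed.

Let homotopic_rel_sym : symmetric homotopic_rel.
Proof.
by move=> p q; apply/asboolP/asboolP; exact: path_homotopic_sym.
Qed.

Let homotopic_rel_trans : transitive homotopic_rel.
Proof.
by move=> q p r /asboolP pq /asboolP qr; apply/asboolP;
  exact: path_homotopic_trans pq qr.
Qed.

Canonical homotopic_equiv :=
  EquivRel homotopic_rel homotopic_rel_refl homotopic_rel_sym
    homotopic_rel_trans.

End concatenation.
End fundamental_group.

(* The quotient topology comes from the compact-open topology that
   {path I from x to x in T} carries. *)
Definition pi1 (R : realType) (T : topologicalType) (x : T) : Type :=
  quotient_topology {eq_quot (@homotopic_equiv R T x)}.

Section pi1_group.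
Context {R : realType} {T : topologicalType} {x : T}.
Local Notation I := (unit_interval R).
Local Notation loop := {path I from x to x in T}.
Local Notation G := (pi1 R x).

HB.instance Definition _ := Topological.on G.
HB.instance Definition _ := Quotient.on G.

Definition pi1_class (p : loop) : G := \pi_G p.

Lemma pi1_classP p q : pi1_class p = pi1_class q <-> path_homotopic p q.
Proof.
split.
  by move=> /(@eqquotP _ _ {eq_quot (@homotopic_equiv R T x)})/asboolP.
by move=> pq; apply/(@eqquotP _ _ {eq_quot (@homotopic_equiv R T x)})/asboolP.
Qed.

Lemma pi1_classK (u : G) : pi1_class (repr u) = u.
Proof. exact: reprK. Qed.

Lemma repr_pi1_class p : path_homotopic (repr (pi1_class p)) p.
Proof. by apply/pi1_classP; rewrite pi1_classK. Qed.

Definition pi1_mul (u v : G) : G := pi1_class (concat (repr u) (repr v)).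
Definition pi1_one : G := pi1_class const_loop.
Definition pi1_inv (u : G) : G := pi1_class (reverse (repr u)).

Lemma pi1_mulE p q :
  pi1_mul (pi1_class p) (pi1_class q) = pi1_class (concat p q).
Proof. by apply/pi1_classP/concat_homotopic; exact: repr_pi1_class. Qed.

Lemma pi1_invE p : pi1_inv (pi1_class p) = pi1_class (reverse p).
Proof. by apply/pi1_classP/reverse_homotopic; exact: repr_pi1_class. Qed.

Let pi1_mulA : associative pi1_mul.
Proof.
move=> u v w; rewrite -(pi1_classK u) -(pi1_classK v) -(pi1_classK w).
by rewrite !pi1_mulE; apply/pi1_classP; exact: concatA.
Qed.

Let pi1_mul1 : left_id pi1_one pi1_mul.
Proof.
move=> u; rewrite -(pi1_classK u) pi1_mulE; apply/pi1_classP; exact: concat1l.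
Qed.

Let pi1_mulr1 : right_id pi1_one pi1_mul.
Proof.
move=> u; rewrite -(pi1_classK u) pi1_mulE; apply/pi1_classP; exact: concat1r.
Qed.

Let pi1_mulV : left_inverse pi1_one pi1_inv pi1_mul.
Proof.
move=> u; rewrite -(pi1_classK u) pi1_invE pi1_mulE.
by apply/pi1_classP; exact: concatVl.
Qed.

Let pi1_mulrV : right_inverse pi1_one pi1_inv pi1_mul.
Proof.
move=> u; rewrite -(pi1_classK u) pi1_invE pi1_mulE.
by apply/pi1_classP; exact: concatVr.
Qed.

HB.instance Definition _ := isGroup.Build G pi1_mulA pi1_mul1 pi1_mulr1
  pi1_mulV pi1_mulrV.

Local Open Scope group_scope.

Lemma pi1_classM p q : pi1_class p * pi1_class q = pi1_class (concat p q).
Proof. exact: pi1_mulE. Qed.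

Lemma pi1_class1 : pi1_class const_loop = 1 :> G.
Proof. by []. Qed.

Lemma pi1_classV p : (pi1_class p)^-1 = pi1_class (reverse p).
Proof. exact: pi1_invE. Qed.
End pi1_group.

Section pi1_map.
Context {R : realType} {T U : topologicalType}.
Local Notation I := (unit_interval R).
(* The base point y is only propositionally equal to f x, so that maps such as
   P_ below, which preserve the base point by a lemma, can be used. *)
Variables (f : T -> U) (x : T) (y : U).
Hypotheses (cf : continuous f) (fxy : f x = y).

Section map_loop.
Variable p : {path I from x to x in T}.

Let map_loop_continuous : continuous (f \o p).
Proof. exact: (continuousT_comp cf (@cts_fun _ _ p)). Qed.

Let map_loop0 : (f \o p) zero = y.
Proof. by rewrite /= path_zero. Qed.

Let map_loop1 : (f \o p) one = y.
Proof. by rewrite /= path_one. Qed.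

Definition map_loop : {path I from y to y in U} :=
  mk_path map_loop_continuous map_loop0 map_loop1.

Lemma map_loopE t : map_loop t = f (p t). Proof. by []. Qed.
End map_loop.

Lemma map_loop_homotopic p q :
  path_homotopic p q -> path_homotopic (map_loop p) (map_loop q).
Proof.
move=> [H [cH H0 H1 Hx Hy]]; exists (f \o H); split => /=.
- exact: (continuousT_comp cf cH).
- by move=> t; rewrite H0.
- by move=> t; rewrite H1.
- by move=> s; rewrite Hx.
- by move=> s; rewrite Hy.
Qed.

Definition pi1_map (u : pi1 R x) : pi1 R y := pi1_class (map_loop (repr u)).

Lemma pi1_mapE p : pi1_map (pi1_class p) = pi1_class (map_loop p).
Proof. by apply/pi1_classP/map_loop_homotopic; exact: repr_pi1_class. Qed.

Local Open Scope group_scope.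

Lemma pi1_mapM : {morph pi1_map : u v / u * v}.
Proof.
move=> u v; rewrite -(pi1_classK u) -(pi1_classK v).
rewrite pi1_classM !pi1_mapE pi1_classM.
congr pi1_class; apply/path_eqP => t.
rewrite map_loopE -[RHS]/(concat_fun _ _ t) -[concat _ _ t]/(concat_fun _ _ t).
by rewrite /concat_fun; case: ifP.
Qed.

Lemma pi1_map1 : pi1_map 1 = 1.
Proof. by apply: (@mulgI _ (pi1_map 1)); rewrite -pi1_mapM !mulg1. Qed.

Lemma pi1_mapV : {morph pi1_map : u / u^-1}.
Proof.
by move=> u; apply: (@mulgI _ (pi1_map u)); rewrite -pi1_mapM !mulgV pi1_map1.
Qed.
End pi1_map.

Section pi1_map_theory.
Context {R : realType}.
Local Notation I := (unit_interval R).

Lemma pi1_map_id (T : topologicalType) (x : T) (f : T -> T)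
    (cf : continuous f) (fx : f x = x) (u : pi1 R x) :
  f =1 id -> pi1_map cf fx u = u.
Proof.
move=> fid; rewrite -(pi1_classK u) pi1_mapE; congr pi1_class.
by apply/path_eqP => t; rewrite map_loopE fid.
Qed.

Lemma pi1_map_comp (S T U : topologicalType) (x : S) (y : T) (z : U)
    (f : S -> T) (g : T -> U) (h : S -> U) (cf : continuous f)
    (cg : continuous g) (ch : continuous h) (fxy : f x = y) (gyz : g y = z)
    (hxz : h x = z) (u : pi1 R x) :
  h =1 g \o f -> pi1_map cg gyz (pi1_map cf fxy u) = pi1_map ch hxz u.
Proof.
move=> hE; rewrite -(pi1_classK u) !pi1_mapE; congr pi1_class.
by apply/path_eqP => t; rewrite !map_loopE hE.
Qed.

Lemma pi1_map_homotopic (T U : topologicalType) (x : T) (y : U)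
    (f g : T -> U) (cf : continuous f) (cg : continuous g) (fxy : f x = y)
    (gxy : g x = y) (F : I * T -> U) :
  continuous F -> (forall w, F (zero, w) = f w) ->
  (forall w, F (one, w) = g w) -> (forall s, F (s, x) = y) ->
  pi1_map (R := R) cf fxy =1 pi1_map cg gxy.
Proof.
move=> cF F0 F1 Fx u; rewrite -(pi1_classK u) !pi1_mapE; apply/pi1_classP.
set p := repr u; exists (fun z => F (z.1, p z.2)); split.
- apply: (continuousT_comp cF).
  apply: continuousT_pair; first exact: continuousT_fst.
  exact: (continuousT_comp (@cts_fun _ _ p) (@continuousT_snd _ _)).
- by move=> t /=; rewrite F0.
- by move=> t /=; rewrite F1.
- by move=> s /=; rewrite path_zero.
- by move=> s /=; rewrite path_one.
Qed.
End pi1_map_theory.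

Definition Zplus (R : realType) : set (R * R) :=
  [set z | exists2 i : nat, (0 < i)%N & z = (i%:R, 0)].
Arguments Zplus : clear implicits.

Definition inj_plane (R : realType) : Type :=
  set_type [set f : {compact-open, Zplus R -> (R * R)%type} | injective f].

HB.instance Definition _ (R : realType) :=
  Topological.copy (inj_plane R)
    (set_type [set f : {compact-open, Zplus R -> (R * R)%type} | injective f]).

Section inj_plane.
Context {R : realType}.
Local Notation X := (inj_plane R).
Local Notation I := (unit_interval R).

Definition ev (f : X) (z : Zplus R) : R * R := \val f z.

Definition mkX (f : Zplus R -> R * R) (finj : injective f) : X :=
  insub_set (A := [set f : {compact-open, Zplus R -> (R * R)%type} |
    injective f]) finj.

Lemma ev_mkX f finj : ev (@mkX f finj) = f. Proof. by []. Qed.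

Lemma ev_inj (f : X) : injective (ev f).
Proof. exact: (set_mem (valP f)). Qed.

Lemma inj_plane_eqP (f g : X) : ev f =1 ev g -> f = g.
Proof. by move=> fg; apply: val_inj; apply/funext. Qed.

Definition idX : X := mkX (f := set_val) val_inj.

(* For z = (i, 0), the index i is the first coordinate (\val z).1. *)
Definition X_ (n : nat) : set X := [set f |
  (forall z : Zplus R, n%:R < (\val z).1 -> ev f z = \val z) /\
  (forall z : Zplus R, (\val z).1 <= n%:R -> (ev f z).1 <= n%:R + 2 / 3)].

(* The infimum is a minimum: see R_ge0, R_bound and R_P. *)
Definition R_ (n : nat) (g : X) : R := inf [set r | 0 <= r /\
  forall z : Zplus R, (\val z).1 <= n%:R -> (ev g z).1 <= n%:R + 2 / 3 + r].

Lemma zpt_subproof (i : nat) : Zplus R (i.+1%:R, 0).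
Proof. by exists i.+1. Qed.

Definition zpt (i : nat) : Zplus R := insub_set (zpt_subproof i).

Lemma zptP (z : Zplus R) : exists i, z = zpt i.
Proof.
have [[|i]// _ zE] := set_mem (valP z).
by exists i; apply: val_inj.
Qed.

Lemma zpt_fst i : (\val (zpt i)).1 = i.+1%:R. Proof. by []. Qed.

Definition Rmax n (g : X) : R :=
  \big[Num.max/0]_(i <- iota 0 n) ((ev g (zpt i)).1 - (n%:R + 2 / 3)).

Lemma RmaxP n g (r : R) : Rmax n g <= r <-> 0 <= r /\
  forall z : Zplus R, (\val z).1 <= n%:R -> (ev g z).1 <= n%:R + 2 / 3 + r.
Proof.
rewrite /Rmax; split.
  move=> gr; split.
    apply: le_trans gr; elim: (iota 0 n) => [|j s ih].
      by rewrite big_nil.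
    by rewrite big_cons le_max ih orbT.
  move=> z; have [i ->] := zptP z; rewrite zpt_fst ler_nat => ltin.
  rewrite -lerBlDl; apply: le_trans gr.
  have : i \in iota 0 n by rewrite mem_iota.
  elim: (iota 0 n) => [//|j s ih]; rewrite inE big_cons le_max => /orP[/eqP->|].
    by rewrite lexx.
  by move=> /ih ->; rewrite orbT.
move=> [r0 gr].
have : all (fun i => i < n)%N (iota 0 n).
  by apply/allP => i; rewrite mem_iota.
elim: (iota 0 n) => [|j s ih]; first by rewrite big_nil.
move=> /= /andP[jn sn]; rewrite big_cons ge_max ih// andbT.
by rewrite lerBlDl; apply: gr; rewrite zpt_fst ler_nat.
Qed.

Lemma R_Rmax n g : R_ n g = Rmax n g.
Proof.
apply/eqP; rewrite eq_le; apply/andP; split.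
  apply: ge_inf; last by apply/RmaxP.
  by exists 0 => r [].
apply: lb_le_inf; first by exists (Rmax n g); apply/RmaxP.
by move=> r /RmaxP.
Qed.

Lemma R_P n g (r : R) : R_ n g <= r <-> 0 <= r /\
  forall z : Zplus R, (\val z).1 <= n%:R -> (ev g z).1 <= n%:R + 2 / 3 + r.
Proof. by rewrite R_Rmax; exact: RmaxP. Qed.

Lemma R_ge0 n g : 0 <= R_ n g.
Proof. by have /R_P[] := lexx (R_ n g). Qed.

Lemma R_bound n g (z : Zplus R) :
  (\val z).1 <= n%:R -> (ev g z).1 <= n%:R + 2 / 3 + R_ n g.
Proof. by have /R_P[_] := lexx (R_ n g); exact. Qed.

Lemma R_eq0 n g : X_ n g -> R_ n g = 0.
Proof.
move=> [_ gn]; apply/eqP; rewrite eq_le R_ge0 andbT; apply/R_P; split => //.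
by move=> z /gn; rewrite addr0.
Qed.

Lemma X_idX n : X_ n idX.
Proof.
by split => // z zn; rewrite (le_trans zn)// lerDl divr_ge0// ler0n.
Qed.

Lemma subset_X_ n : X_ n `<=` X_ n.+1.
Proof.
move=> f [f1 f2]; split.
  by move=> z zn; apply: f1; apply: le_lt_trans zn; rewrite ler_nat.
move=> z zn; have [zn'|zn'] := leP (\val z).1 n%:R.
  by rewrite (le_trans (f2 _ zn'))// lerD2r ler_nat.
by rewrite f1// (le_trans zn)// lerDl divr_ge0// ler0n.
Qed.

(* P_ n is the case r = R_ n g; a general r is used for the homotopy in
   phi_phiS. *)
Definition shift_fun (n : nat) (g : X) (r : R) (z : Zplus R) : R * R :=
  if (\val z).1 <= n%:R then ((ev g z).1 - r, (ev g z).2) else \val z.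

Lemma shift_fun_bound n g r (z : Zplus R) : R_ n g <= r ->
  (\val z).1 <= n%:R -> (shift_fun n g r z).1 <= n%:R + 2 / 3.
Proof.
move=> gr zn; rewrite /shift_fun zn /= lerBlDr.
by rewrite (le_trans (R_bound _ zn))// lerD2l.
Qed.

Lemma shift_fun_inj n g r : R_ n g <= r -> injective (shift_fun n g r).
Proof.
move=> gr.
have aux (z w : Zplus R) : (\val z).1 <= n%:R -> n%:R < (\val w).1 ->
    shift_fun n g r z = shift_fun n g r w -> z = w.
  move=> zn wn zw; have := shift_fun_bound gr zn; rewrite zw.
  rewrite /shift_fun ifF; last by rewrite leNgt wn.
  move=> wle; exfalso.
  have [i wE] := zptP w; move: wn wle; rewrite wE zpt_fst ltr_nat => ni.
  rewrite leNgt => /negP; apply; apply: (@lt_le_trans _ _ n.+1%:R).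
    by rewrite -[ltRHS]natr1 ltrD2l; lra.
  by rewrite ler_nat.
move=> z w; have [zn|zn] := leP (\val z).1 n%:R.
  have [wn|wn] := leP (\val w).1 n%:R; last exact: aux.
  rewrite /shift_fun zn wn => -[/addIr e1 e2].
  by apply: (@ev_inj g); rewrite (surjective_pairing (ev g z)) e1 e2;
    rewrite -surjective_pairing.
have [wn|wn] := leP (\val w).1 n%:R; first by move=> /esym/aux => /(_ wn zn) ->.
rewrite /shift_fun ifF; last by rewrite leNgt zn.
by rewrite ifF; [exact: val_inj|rewrite leNgt wn].
Qed.

Definition shift n g r (gr : R_ n g <= r) : X := mkX (shift_fun_inj gr).

Lemma X_shift n g r (gr : R_ n g <= r) : X_ n (shift gr).
Proof.
split=> z zn; last exact: shift_fun_bound.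
by rewrite ev_mkX /shift_fun ifF// leNgt zn.
Qed.

Lemma shift_eq n g g' r r' (gr : R_ n g <= r) (gr' : R_ n g' <= r') :
  (forall z : Zplus R, (\val z).1 <= n%:R ->
    ((ev g z).1 - r, (ev g z).2) = ((ev g' z).1 - r', (ev g' z).2)) ->
  shift gr = shift gr'.
Proof.
move=> gg'; apply: inj_plane_eqP => z; rewrite !ev_mkX /shift_fun.
by case: ifP => // /gg'.
Qed.

Definition P_ (n : nat) (g : X) : X_ n :=
  insub_set (X_shift (lexx (R_ n g))).

Definition idX_ (n : nat) : X_ n := insub_set (X_idX n).

Lemma shift_idem n g r (gr : R_ n g <= r) : X_ n g -> r = 0 -> shift gr = g.
Proof.
move=> [gn _] r0; apply: inj_plane_eqP => z; rewrite ev_mkX /shift_fun r0 subr0.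
by rewrite -surjective_pairing; case: leP => // /gn.
Qed.

Lemma P_retract n (f : X_ n) : P_ n (\val f) = f.
Proof.
apply: val_inj; apply: shift_idem; first exact: set_mem (valP f).
by apply: R_eq0; exact: set_mem (valP f).
Qed.

Lemma P_idX n : P_ n idX = idX_ n.
Proof. exact: (P_retract (idX_ n)). Qed.

Lemma ev_continuous (z : Zplus R) : continuous (fun f : X => ev f z).
Proof.
have ce : continuous
    (fun f : {compact-open, Zplus R -> (R * R)%type} => f z).
  move=> f A /=; rewrite nbhsE => -[B [oB Bf] BA].
  have : nbhs f [set g : {compact-open, Zplus R -> (R * R)%type} |
      g @` [set z] `<=` B].
    apply: open_nbhs_nbhs; split; last by move=> _ [_ -> <-].
    by apply: compact_open_open => //; exact: compact_set1.
  by apply: filterS => g gB; apply: BA; apply: gB; exists z.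
exact: (continuousT_comp ce (@initial_continuous _ _ _)).
Qed.

Lemma Zplus_discrete (z : Zplus R) : nbhs z [set z].
Proof.
have [i zE] := zptP z.
have : nbhs z ((fun w : Zplus R => (\val w).1) @^-1`
    [set r : R | i.+1%:R - 2^-1 < r < i.+1%:R + 2^-1]).
  have cv : continuous (fun w : Zplus R => (\val w).1).
    exact: (continuousT_comp (@continuousT_fst _ _) (@initial_continuous _ _ _)).
  apply: cv; apply: open_nbhs_nbhs; split.
    rewrite (_ : [set r | _] =
      [set r : R | i.+1%:R - 2^-1 < r] `&` [set r | r < i.+1%:R + 2^-1]).
      by apply: openI; [exact: open_gt|exact: open_lt].
    by apply/seteqP; split => r /= => [/andP[]|[-> ->]].
  by rewrite /= zE zpt_fst; apply/andP; split; lra.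
apply: filterS => w /=; have [j ->] := zptP w; rewrite zE !zpt_fst.
move=> /andP[ij ji].
have /[!ltr_nat] lt_ji : (j.+1%:R : R) < i.+2%:R by rewrite -[ltRHS]natr1; lra.
have /[!ltr_nat] lt_ij : (i.+1%:R : R) < j.+2%:R by rewrite -[ltRHS]natr1; lra.
by congr zpt; apply/anti_leq; apply/andP; split; rewrite -ltnS.
Qed.

Lemma inj_plane_continuous (S : topologicalType) (F : S -> X) :
  (forall z, continuous (fun s => ev (F s) z)) -> continuous F.
Proof.
move=> cF; apply: continuous_comp_initial => s.
apply/compact_open_cvgP => K O cK oO FKO.
suff : \forall t \near s, K `<=` [set z | O (ev (F t) z)].
  by apply: filterS => t tO _ [z Kz <-]; exact: tO.
move: cK => /compact_near_coveringP; apply => z Kz.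
exists ([set z], [set t | O (ev (F t) z)]) => /=.
  split; first exact: Zplus_discrete.
  apply: cF; apply: open_nbhs_nbhs; split => //.
  by apply: FKO; exists z.
by move=> [w t] /= [-> Ot].
Qed.

Lemma R_continuous n : continuous (R_ n).
Proof.
have -> : R_ n = Rmax n by apply: funext => g; exact: R_Rmax.
rewrite /Rmax; elim: (iota 0 n) => [|j s ih].
  under eq_fun do rewrite big_nil; exact: continuousT_cst.
under eq_fun do rewrite big_cons; apply: continuousT_max => //.
apply: continuousT_B; last exact: continuousT_cst.
exact: (continuousT_comp (@continuousT_fst R R) (@ev_continuous (zpt j))).
Qed.

Lemma shift_continuous (S : topologicalType) n (g : S -> X) (r : S -> R)
    (gr : forall s, R_ n (g s) <= r s) :
  continuous g -> continuous r -> continuous (fun s => shift (gr s)).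
Proof.
move=> cg cr; apply: inj_plane_continuous => z.
change (continuous (fun s => shift_fun n (g s) (r s) z)).
have cev : continuous (fun s => ev (g s) z).
  exact: (continuousT_comp (@ev_continuous z) cg).
rewrite /shift_fun; case: ((\val z).1 <= n%:R); last exact: continuousT_cst.
apply: continuousT_pair.
  apply: continuousT_B => //.
  exact: (continuousT_comp (@continuousT_fst _ _) cev).
exact: (continuousT_comp (@continuousT_snd _ _) cev).
Qed.

Lemma P_continuous n : continuous (P_ n).
Proof.
apply: continuous_comp_initial.
apply: (@shift_continuous _ _ id (R_ n)); last exact: R_continuous.
by move=> ?.
Qed.

Lemma incl_continuous n : continuous (set_val : X_ n -> X).
Proof. exact: initial_continuous. Qed.
End inj_plane.

Notation top_pi1 R := (pi1 R (@idX R)).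

Section filtration.
Context {R : realType}.
Local Notation X := (inj_plane R).
Local Notation I := (unit_interval R).
Local Notation G := (top_pi1 R).
Local Open Scope group_scope.

Definition P_star (n : nat) : G -> pi1 R (@idX_ R n) :=
  pi1_map (P_continuous (n := n)) (P_idX n).

Definition i_star (n : nat) : pi1 R (@idX_ R n) -> G :=
  pi1_map (incl_continuous (n := n)) erefl.
Arguments i_star : clear implicits.

(* G_ n and K_ n are subsets of G and phi_ n takes values in G_ n (G_phi). *)
Definition G_ (n : nat) : set G := if n is 0 then [set 1] else range (i_star n).

Definition phi_ (n : nat) : G -> G :=
  if n is 0 then fun=> 1 else i_star n \o P_star n.

(* Only used for n >= 1. *)
Definition K_ (n : nat) : set G := G_ n `&` [set g | phi_ n.-1 g = 1].

Lemma i_starM n : {morph i_star n : u v / u * v}.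
Proof. exact: pi1_mapM. Qed.

Lemma phi_M n : {morph phi_ n : u v / u * v}.
Proof.
case: n => [u v|n u v]; first by rewrite /= mulg1.
by rewrite /phi_ /= /P_star pi1_mapM; exact: pi1_mapM.
Qed.

Lemma phi_1 n : phi_ n 1 = 1.
Proof. by apply: (@mulgI _ (phi_ n 1)); rewrite -phi_M !mulg1. Qed.

Lemma phi_V n : {morph phi_ n : u / u^-1}.
Proof.
by move=> u; apply: (@mulgI _ (phi_ n u)); rewrite -phi_M !mulgV phi_1.
Qed.

Lemma G_phi n u : G_ n (phi_ n u).
Proof. by case: n => [//|n]; exists (P_star n.+1 u). Qed.

Lemma phi_G n u : G_ n u -> phi_ n u = u.
Proof.
case: n => [/= -> //|n [w _ <-]]; rewrite /phi_ /=; congr i_star.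
rewrite /P_star /i_star.
have cid : continuous (id : @X_ R n.+1 -> @X_ R n.+1) by move=> ?.
rewrite (pi1_map_comp _ _ cid _ _ (erefl (idX_ n.+1))).
  exact: pi1_map_id.
by move=> f /=; rewrite P_retract.
Qed.

Lemma G_M n u v : G_ n u -> G_ n v -> G_ n (u * v).
Proof. by move=> /phi_G <- /phi_G <-; rewrite -phi_M; exact: G_phi. Qed.

Lemma G_V n u : G_ n u -> G_ n u^-1.
Proof. by move=> /phi_G <-; rewrite -phi_V; exact: G_phi. Qed.

Lemma G_1 n : G_ n 1.
Proof. by rewrite -(phi_1 n); exact: G_phi. Qed.

Lemma G_S n : G_ n `<=` G_ n.+1.
Proof.
case: n => [_ ->|n _ [w _ <-]]; first exact: G_1.
have sub (f : @X_ R n.+1) : @X_ R n.+2 (\val f).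
  by apply: subset_X_; exact: set_mem (valP f).
pose j (f : @X_ R n.+1) : @X_ R n.+2 := insub_set (sub f).
have cj : continuous j.
  by apply: continuous_comp_initial; exact: initial_continuous.
have jid : j (idX_ n.+1) = idX_ n.+2 by exact: val_inj.
exists (pi1_map cj jid w) => //; exact: pi1_map_comp.
Qed.

Lemma phi_phiS n u : phi_ n (phi_ n.+1 u) = phi_ n u.
Proof.
case: n => [//|n]; rewrite /phi_ /= /P_star /i_star.
pose Q m (g : X) : X := \val (P_ m g).
have cQ m : continuous (Q m).
  exact: (continuousT_comp (@incl_continuous R m) (P_continuous (n := m))).
have Qid m : Q m idX = idX by rewrite /Q P_idX.
rewrite (pi1_map_comp _ _ (cQ n.+2) _ _ (Qid _) u)//.
rewrite (pi1_map_comp _ _ (cQ n.+1) _ _ (Qid _))//.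
rewrite [RHS](pi1_map_comp _ _ (cQ n.+1) _ _ (Qid _) u)//.
have cQQ : continuous (Q n.+1 \o Q n.+2).
  exact: (continuousT_comp (cQ n.+1) (cQ n.+2)).
have QQid : (Q n.+1 \o Q n.+2) idX = idX by rewrite /= !Qid.
rewrite (pi1_map_comp _ _ cQQ _ _ QQid)//.
set m := n.+1.
pose a (g : X) : R := (R_ m.+1 g + R_ m (Q m.+1 g))%R.
have aR g : R_ m g <= a g.
  apply/R_P; split; first by rewrite addr_ge0// R_ge0.
  move=> z zm; have := R_bound (Q m.+1 g) zm.
  rewrite /Q /= ev_mkX /shift_fun (le_trans zm) ?ler_nat//= /a /Q.
  by rewrite lerBlDr => /le_trans; apply; rewrite -!addrA [(R_ m _ + _)%R]addrC.
have bR (z : I * X) :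
    R_ m z.2 <= ((1 - ival z.1) * a z.2 + ival z.1 * R_ m z.2)%R.
  have /andP[t0 t1] := ivalP z.1.
  rewrite -[leLHS]mul1r -{1}(subrK (ival z.1) 1%R) mulrDl lerD2r.
  by rewrite ler_wpM2l// subr_ge0.
apply: (@pi1_map_homotopic _ _ _ _ _ _ _ _ _ _ _ (fun z => shift (bR z))).
- apply: shift_continuous; first exact: continuousT_snd.
  have ci : continuous (fun z : I * X => ival z.1).
    exact: (continuousT_comp ival_continuous (@continuousT_fst _ _)).
  have cR k : continuous (fun z : I * X => R_ k z.2).
    exact: (continuousT_comp (@R_continuous R k) (@continuousT_snd _ _)).
  apply: continuousT_D; apply: continuousT_M => //.
    by apply: continuousT_B => //; exact: continuousT_cst.
  apply: continuousT_D => //.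
  apply: (continuousT_comp (@R_continuous R m)).
  exact: (continuousT_comp (cQ m.+1) (@continuousT_snd _ _)).
- move=> g /=; apply: shift_eq => z zm /=.
  rewrite /Q /= ev_mkX /shift_fun (le_trans zm) ?ler_nat//=.
  by rewrite ival0 subr0 mul1r mul0r addr0 /a opprD addrA.
- move=> g /=; apply: shift_eq => z zm /=.
  by rewrite ival1 subrr mul1r mul0r add0r.
- move=> s /=; apply: shift_idem => /=; first exact: X_idX.
  by rewrite /a Qid !(R_eq0 (X_idX _)) addr0 !mulr0 addr0.
Qed.

Lemma K_phi n g : K_ n.+1 ((phi_ n g)^-1 * phi_ n.+1 g).
Proof.
split.
  by apply: G_M; [apply: G_V; apply: G_S|]; exact: G_phi.
by rewrite /= phi_M phi_V phi_phiS (phi_G (G_phi _ _)) mulVg.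
Qed.

Lemma K_1 n : K_ n 1.
Proof. by split; [exact: G_1|exact: phi_1]. Qed.

Lemma K_M n u v : K_ n u -> K_ n v -> K_ n (u * v).
Proof.
move=> [Gu ku] [Gv kv]; split; first exact: G_M.
by rewrite /= phi_M ku kv mulg1.
Qed.

Lemma K_V n u : K_ n u -> K_ n u^-1.
Proof.
by move=> [Gu ku]; split; [exact: G_V|rewrite /= phi_V ku invg1].
Qed.

Lemma K_conj n u v : G_ n v -> K_ n u -> K_ n (v^-1 * u * v).
Proof.
move=> Gv [Gu ku]; split; first by do 2![apply: G_M => //]; exact: G_V.
by rewrite /= !phi_M phi_V ku mulg1 mulVg.
Qed.

End filtration.

(* Coordinates are numbered from 0: coordinate n of x is the entry x_(n+1), an
   element of K_ n.+1. *)
Definition twisted_product (R : realType) : Type :=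
  prod_topology (fun n : nat => discrete_topology (@K_ R n.+1)).

HB.instance Definition _ (R : realType) := Topological.copy (twisted_product R)
  (prod_topology (fun n : nat => discrete_topology (@K_ R n.+1))).

Section twisted_product.
Context {R : realType}.
Local Notation G := (top_pi1 R).
Local Notation Pi := (twisted_product R).
Local Open Scope group_scope.
Implicit Types x y z : Pi.

Definition component (x : Pi) (n : nat) : G := \val (x n : K_ n.+1).

(* x_1 * ... * x_n *)
Definition partial_product (x : Pi) (n : nat) : G :=
  \big[*%g/1]_(j < n) component x j.

Lemma componentP x n : K_ n.+1 (component x n).
Proof. exact: set_mem (valP (x n : K_ n.+1)). Qed.

Lemma partial_productS x n :
  partial_product x n.+1 = partial_product x n * component x n.
Proof. exact: big_ord_recr. Qed.

Lemma partial_product0 x : partial_product x 0 = 1.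
Proof. exact: big_ord0. Qed.

Lemma partial_product_G x n : G_ n (partial_product x n).
Proof.
elim: n => [|n ih]; first by rewrite partial_product0; exact: G_1.
rewrite partial_productS; apply: G_M; first exact: G_S.
by have [] := componentP x n.
Qed.

Lemma twisted_mul_subproof x y n : K_ n.+1
  ((partial_product y n)^-1 * component x n * partial_product y n
   * component y n).
Proof.
apply: K_M; last exact: componentP.
apply: K_conj; last exact: componentP.
by apply: G_S; exact: partial_product_G.
Qed.

Definition twisted_mul x y : Pi := fun n => insub_set (twisted_mul_subproof x y n).

Definition twisted_one : Pi := fun n => insub_set (K_1 n.+1).

Lemma twisted_inv_subproof x n : K_ n.+1
  (partial_product x n * (component x n)^-1 * (partial_product x n)^-1).
Proof.
rewrite -{1}(invgK (partial_product x n)); apply: K_conj; last exact/K_V/componentP.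
by apply: G_V; apply: G_S; exact: partial_product_G.
Qed.

Definition twisted_inv x : Pi := fun n => insub_set (twisted_inv_subproof x n).

Lemma partial_product_inj x y : partial_product x =1 partial_product y -> x = y.
Proof.
move=> xy; apply: functional_extensionality_dep => n; apply: val_inj.
apply: (@mulgI _ (partial_product x n)); rewrite -[LHS]partial_productS.
by rewrite xy [RHS](_ : _ = partial_product y n.+1)// partial_productS xy.
Qed.

Lemma partial_productM x y n : partial_product (twisted_mul x y) n =
  partial_product x n * partial_product y n.
Proof.
elim: n => [|n ih]; first by rewrite !partial_product0 mulg1.
rewrite !partial_productS ih {2}/component /=.
by rewrite !mulgA mulgK.
Qed.

Lemma partial_product1 n : partial_product twisted_one n = 1.
Proof. by rewrite /partial_product big1. Qed.

Lemma partial_productV x n :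
  partial_product (twisted_inv x) n = (partial_product x n)^-1.
Proof.
elim: n => [|n ih]; first by rewrite !partial_product0 invg1.
rewrite !partial_productS ih {2}/component /= invgM.
by rewrite !mulgA mulVg mul1g.
Qed.

Lemma twisted_mulA : associative twisted_mul.
Proof.
by move=> x y z; apply: partial_product_inj => n; rewrite !partial_productM mulgA.
Qed.

Lemma twisted_mul1 : left_id twisted_one twisted_mul.
Proof.
move=> x; apply: partial_product_inj => n.
by rewrite partial_productM partial_product1 mul1g.
Qed.

Lemma twisted_mulr1 : right_id twisted_one twisted_mul.
Proof.
move=> x; apply: partial_product_inj => n.
by rewrite partial_productM partial_product1 mulg1.
Qed.

Lemma twisted_mulV : left_inverse twisted_one twisted_inv twisted_mul.
Proof.
move=> x; apply: partial_product_inj => n.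
by rewrite partial_productM partial_productV partial_product1 mulVg.
Qed.

Lemma twisted_mulrV : right_inverse twisted_one twisted_inv twisted_mul.
Proof.
move=> x; apply: partial_product_inj => n.
by rewrite partial_productM partial_productV partial_product1 mulgV.
Qed.

HB.instance Definition _ := isGroup.Build Pi twisted_mulA twisted_mul1
  twisted_mulr1 twisted_mulV twisted_mulrV.

Definition phi (g : G) : Pi := fun n => insub_set (K_phi n g).

Lemma phi_partial_product g n : partial_product (phi g) n = phi_ n g.
Proof.
elim: n => [|n ih]; first by rewrite partial_product0.
by rewrite partial_productS ih /component /= mulgA mulgV mul1g.
Qed.

Lemma phiM : {morph phi : g h / g * h}.
Proof.
move=> g h; apply: partial_product_inj => n.
rewrite [RHS]partial_productM !phi_partial_product; exact: phi_M.
Qed.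
End twisted_product.

Definition homeomorphism (S T : topologicalType) (f : S -> T) : Prop :=
  exists g : T -> S, [/\ cancel f g, cancel g f, continuous f & continuous g].

Definition is_metric (R : realType) (T : Type) (d : T -> T -> R) : Prop :=
  [/\ (forall x y, 0 <= d x y), (forall x y, d x y = 0 <-> x = y),
      (forall x y, d x y = d y x) &
      (forall x y z, d x z <= d x y + d y z)].

Definition metric_complete (R : realType) (T : Type) (d : T -> T -> R) : Prop :=
  forall u : nat -> T,
    (forall e : R, 0 < e -> exists N : nat, forall m n : nat,
      (N <= m)%N -> (N <= n)%N -> d (u m) (u n) < e) ->
    exists l : T, forall e : R, 0 < e -> exists N : nat, forall n : nat,
      (N <= n)%N -> d l (u n) < e.

Definition topologically_complete (R : realType) (T : topologicalType) : Prop :=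
  exists d : T -> T -> R,
    [/\ is_metric d, metric_complete d &
        forall (x : T) (A : set T), nbhs x A <->
          exists2 e : R, 0 < e & [set y | d x y < e] `<=` A].

(* Main.v *)
(* Write the i-th strand of f in X for f(i,0). A homotopy of the first n strands
   is carried by an ambient isotopy of the plane, a composition of finitely many
   maps z + sum_i b_i(z) (c'_i - c_i) with Lipschitz bumps b_i; applying it to
   the remaining strands extends the homotopy to X. So phi_n determines the
   first n strands of a loop up to homotopy in X. Taking limits strand by strand
   yields surjectivity, and, since the topology on loops only sees finitely many
   strands at a time, yields that the classes with a prescribed value of phi_n
   form a neighbourhood base.

   For injectivity, let all phi_n kill p, and suppose that its first n strands
   are constant already. The null-homotopy K of the first n+1 strands may move
   the first n of them, which is an obstruction in pi_2 of a configuration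
   space; it disappears after concatenating K with the reverse of s(K), where s
   replaces strand n+1 by a point far to the right depending on the first n
   strands only: these now retrace their motion, which an ambient isotopy undoes.
   Hence strand n+1 can be made constant with the first n strands fixed, and the
   infinite concatenation of these homotopies is continuous because each strand
   is eventually constant.

   G is complete for the ultrametric given by the least n at which phi_n
   separates two classes. *)
Require Import Defs.
From mathcomp Require Import all_boot all_order all_algebra.
From mathcomp Require Import all_classical all_reals topology normedtype.
From mathcomp Require Import interval_inference.
From mathcomp Require Import homotopy lra.

Set Implicit Arguments.
Unset Strict Implicit.
Unset Printing Implicit Defensive.

Import Order.TTheory GRing.Theory Num.Theory.
Import numFieldNormedType.Exports.

Local Open Scope classical_set_scope.
Local Open Scope ring_scope.

(** * Elementary continuity and norm estimates *)

Lemma dist_max0 (R : realDomainType) (a b : R) :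
  `|Num.max 0 a - Num.max 0 b| <= `|a - b|.
Proof.
have := ler_norm (a - b); have := ler_norm (b - a); rewrite (distrC b a).
have [a0|a0] := leP 0 a; have [b0|b0] := leP 0 b => h1 h2;
  by rewrite ler_norml; apply/andP; split; lra.
Qed.

Section continuousV.
Context {R : realType} {V : normedModType R} {Z : topologicalType}.
Implicit Types f g : Z -> V.

Lemma continuousV_D f g :
  continuous f -> continuous g -> continuous (fun z => f z + g z).
Proof. by move=> cf cg z; apply: cvgD; [exact: cf|exact: cg]. Qed.

Lemma continuousV_B f g :
  continuous f -> continuous g -> continuous (fun z => f z - g z).
Proof. by move=> cf cg z; apply: cvgB; [exact: cf|exact: cg]. Qed.

Lemma continuousV_norm f : continuous f -> continuous (fun z => `|f z|).
Proof. by move=> cf z; apply: cvg_norm; exact: cf. Qed.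

Lemma continuousV_sum (J : Type) (r : seq J) (F : J -> Z -> V) :
  (forall j, continuous (F j)) -> continuous (fun z => \sum_(j <- r) F j z).
Proof.
move=> cF; elim: r => [|j r ih].
  by under eq_fun do rewrite big_nil; exact: continuousT_cst.
by under eq_fun do rewrite big_cons; exact: continuousV_D.
Qed.
End continuousV.

(** * Moving finitely many points by an injective map *)

Section point_push.
Context {R : realType} {V : normedModType R} {n : nat}.
Implicit Types (d : R) (c : 'I_n -> V) (z : V).

Definition bump d z0 z : R := Num.max 0 (1 - `|z - z0| / d).

Lemma bump_lipschitz d z0 z w : 0 < d ->
  `|bump d z0 z - bump d z0 w| <= `|z - w| / d.
Proof.
move=> d0; apply: (le_trans (dist_max0 _ _)).
rewrite (_ : _ - _ = (`|w - z0| - `|z - z0|) / d); last by rewrite mulrBl; lra.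
rewrite normrM normfV (gtr0_norm d0) ler_pM2r ?invr_gt0//.
rewrite (le_trans (ler_dist_dist _ _))//.
by rewrite opprB addrA subrK distrC.
Qed.

Definition push d c c' z : V :=
  z + \sum_(i < n) bump d (c i) z *: (c' i - c i).

Lemma push_id d c c' z : c =1 c' -> push d c c' z = z.
Proof.
move=> cc'; rewrite /push big1 ?addr0// => i _.
by rewrite cc' subrr scaler0.
Qed.

Lemma push_point d c c' i : 0 < d ->
  (forall i j, i != j -> d <= `|c i - c j|) -> push d c c' (c i) = c' i.
Proof.
move=> d0 sep; rewrite /push (bigD1 i)//= big1 ?addr0; last first.
  move=> j ji; rewrite /bump (max_idPl _) ?scale0r//.
  by rewrite subr_le0 ler_pdivlMr// mul1r sep// eq_sym.
rewrite /bump subrr normr0 mul0r subr0 (max_idPr ler01) scale1r.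
by rewrite addrC subrK.
Qed.

(** The displacement is Lipschitz with constant the sum of the norms of the [c' i - c i] divided by
    [d], which is below 1; the identity plus a strict contraction is injective. *)
Lemma push_inj d c c' : 0 < d -> \sum_(i < n) `|c' i - c i| < d ->
  injective (push d c c').
Proof.
move=> d0 cd z w zw; apply: contrapT => /eqP; rewrite -subr_eq0 -normr_gt0.
move=> zw0.
have : z - w = \sum_(i < n) (bump d (c i) w - bump d (c i) z) *: (c' i - c i).
  under eq_bigr do rewrite scalerBl.
  rewrite big_split/= sumrN; set Sw := \sum_(i < n) _; set Sz := \sum_(i < n) _.
  have {}zw : z + Sz = w + Sw by exact: zw.
  by rewrite -[z](addrK Sz) zw [w + Sw]addrC addrAC addrK.
move=> /(congr1 Num.norm) zwE.
have : `|z - w| <= `|z - w| / d * \sum_(i < n) `|c' i - c i|.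
  rewrite {1}zwE mulr_sumr; apply: (le_trans (ler_norm_sum _ _ _)).
  apply: ler_sum => i _; rewrite normrZ ler_wpM2r// distrC.
  exact: bump_lipschitz.
rewrite -mulrA ler_pMr// mulrC ler_pdivlMr// mul1r leNgt; exact/negP/negPn.
Qed.

Lemma push_continuous (Z : topologicalType) d (c c' : 'I_n -> Z -> V)
    (f : Z -> V) : (forall i, continuous (c i)) ->
  (forall i, continuous (c' i)) -> continuous f ->
  continuous (fun x => push d (c^~ x) (c'^~ x) (f x)).
Proof.
move=> cc cc' cf; apply: continuousV_D => //; apply: continuousV_sum => i.
move=> x; apply: cvgZ; last by apply: cvgB; [exact: cc'|exact: cc].
apply: (@continuousT_max R Z (cst 0)); first exact: continuousT_cst.
apply: continuousT_B; first exact: continuousT_cst.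
apply: continuousT_M; last exact: continuousT_cst.
by move=> y; apply: cvg_norm; apply: cvgB; [exact: cf|exact: cc].
Qed.
End point_push.

(** * Compactness and ambient isotopies *)

Lemma unit_interval_compact (R : realType) : compact [set: unit_interval R].
Proof.
have -> : [set: unit_interval R] = clamp @` `[0, 1]%classic.
  rewrite eqEsubset; split=> // t _; exists (ival t); last exact: ivalK.
  by rewrite /= in_itv/= ivalP.
apply: continuous_compact; last exact: segment_compact.
exact/continuous_subspaceT/clamp_continuous.
Qed.

Lemma compactT_prod (S T : topologicalType) :
  compact [set: S] -> compact [set: T] -> compact [set: S * T].
Proof. by move=> cS cT; rewrite -setXTT; exact: compact_setX. Qed.

Section ambient_isotopy.
Context {R : realType} {V : normedModType R} {n : nat}.
Local Notation I := (unit_interval R).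

(** Each pair of points has a positive continuous distance on a compact space. Covering compactness
    replaces attained minima, so that an empty [B] needs no separate case. *)
Lemma separation_bound (B : topologicalType) (W : 'I_n -> B -> V) :
  compact [set: B] -> (forall i, continuous (W i)) ->
  (forall b, injective (W^~ b)) ->
  exists2 d : R, 0 < d &
    forall b i j, i != j -> d <= `|W i b - W j b|.
Proof.
move=> /compact_near_coveringP cB cW injW.
suff [d /= d0 dW] : \forall d \near (0 : R)^'+, forall ij : 'I_n * 'I_n,
    ij.1 != ij.2 -> [set: B] `<=` [set b | d <= `|W ij.1 b - W ij.2 b|].
  exists (d / 2); first by rewrite divr_gt0.
  move=> b i j ij; apply: (dW (d / 2) _ _ (i, j) ij) => //=.
    by rewrite sub0r normrN gtr0_norm ?divr_gt0//; lra.
  by rewrite divr_gt0.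
apply: filter_forall => -[i j] /=.
have [->|ij] := eqVneq i j; first by apply: filterE.
suff : \forall d \near (0 : R)^'+,
    [set: B] `<=` [set b | d <= `|W i b - W j b|] by apply: filterS.
apply: cB => b _.
pose e := `|W i b - W j b|.
have e0 : 0 < e by rewrite normr_gt0 subr_eq0; apply: contra_neq ij => /injW.
have : nbhs b ((fun b => `|W i b - W j b|) @^-1` [set r | e / 2 < r]).
  apply: (continuousV_norm (continuousV_B (cW i) (cW j))).
  by apply: open_nbhs_nbhs; split; [exact: open_gt|rewrite /= -/e; lra].
move=> nb; exists ([set b | e / 2 < `|W i b - W j b|], [set d | d < e / 2]).
  by split => //=; apply: nbhs_right_lt; rewrite divr_gt0.
by move=> [b' d] /= [b'e de]; apply: ltW; apply: lt_trans b'e.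
Qed.

(** Uniform continuity in the homotopy parameter, by compactness of [I * B]. *)
Lemma homotopy_subdivision (B : topologicalType) (W : 'I_n -> I * B -> V)
    (e : R) : compact [set: B] -> (forall i, continuous (W i)) -> 0 < e ->
  exists N : nat, forall i u u' b, `|ival u - ival u'| <= N.+1%:R^-1 ->
    `|W i (u, b) - W i (u', b)| < e.
Proof.
move=> cB cW e0.
have /compact_near_coveringP cIB :=
  compactT_prod (@unit_interval_compact R) cB.
suff [N _ NW] : \forall N \near \oo, forall i : 'I_n, [set: I * B] `<=`
    [set x | forall u, `|ival x.1 - ival u| <= N.+1%:R^-1 ->
      `|W i x - W i (u, x.2)| < e].
  by exists N => i u u' b; exact: (NW N (leqnn N) i (u, b)).
apply: filter_forall => i; apply: cIB => -[u0 b0] _.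
(* Clamping extends [W i] to a real parameter, so that neighbourhoods of [ival u0] contain balls of
   an explicit radius [r]. *)
pose Wc (x : R * B) := W i (clamp x.1, x.2).
have cWc : continuous Wc.
  apply: (continuousT_comp (cW i)); apply: continuousT_pair.
    exact: (continuousT_comp clamp_continuous (@continuousT_fst _ _)).
  exact: continuousT_snd.
have : nbhs (ival u0, b0)
    (Wc @^-1` [set z | `|Wc (ival u0, b0) - z| < e / 2]).
  by have /cvgrPdist_lt := cWc (ival u0, b0); apply; rewrite divr_gt0.
move=> [[A C] /= [[r /= r0 rA] Cb] AC].
exists ([set x : I * B | `|ival u0 - ival x.1| < r / 2 /\ C x.2],
        [set N | N.+1%:R^-1 < r / 2]).
  split => /=.
    apply: filterI; last exact: (@continuousT_snd _ _ (u0, b0)).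
    have ci : continuous (fun x : I * B => ival x.1).
      exact: (continuousT_comp ival_continuous (@continuousT_fst _ _)).
    by have /cvgrPdist_lt := ci (u0, b0); apply; rewrite divr_gt0.
  have r20 : 0 < r / 2 by rewrite divr_gt0.
  exact: (near_infty_natSinv_lt (PosNum r20)).
move=> [[u b] N] /= [[ur Cb'] Nr] u' uu'.
have Wur v : `|ival u0 - ival v| < r ->
    `|Wc (ival u0, b0) - W i (v, b)| < e / 2.
  move=> vr; have := AC (ival v, b) (conj (rA (ival v) vr) Cb').
  by rewrite /= {2}/Wc /= ivalK.
have u'r : `|ival u0 - ival u'| < r.
  apply: (le_lt_trans (ler_distD (ival u) _ _)).
  by have := le_lt_trans uu' Nr; lra.
have {}ur : `|ival u0 - ival u| < r by lra.
apply: (le_lt_trans (ler_distD (Wc (ival u0, b0)) _ _)).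
by rewrite distrC; have := Wur _ ur; have := Wur _ u'r; lra.
Qed.

(** [Psi] follows [W] by composing small pushes. The last clause, that nothing moves before [W]
    does, is what later preserves initial loops and endpoints. *)
Lemma ambient_isotopy (B : topologicalType) (W : 'I_n -> I * B -> V) :
  compact [set: B] -> (forall i, continuous (W i)) ->
  (forall x, injective (W^~ x)) ->
  exists Psi : I * B -> V -> V,
    [/\ continuous (fun x : (I * B) * V => Psi x.1 x.2),
        (forall x, injective (Psi x)),
        (forall u b i, Psi (u, b) (W i (zero, b)) = W i (u, b)) &
        (forall u b z, (forall i v, ival v <= ival u ->
          W i (v, b) = W i (zero, b)) -> Psi (u, b) z = z)].
Proof.
move=> cB cW injW.
have [d d0 sepd] :=
  separation_bound (compactT_prod (@unit_interval_compact R) cB) cW injW.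
(* With this bound on each of the [n] displacements of a step, their sum stays below [d], as
   [push_inj] requires. *)
have dn0 : 0 < d / n.+1%:R by rewrite divr_gt0.
have [N NW] := homotopy_subdivision cB cW dn0.
(* Time truncated at [k / N.+1]. Step [k] pushes from time [tk k u] to [tk k.+1 u]; it is trivial
   once [u] is passed, and [Psi] is continuous in [u] without gluing. *)
pose tk k (u : I) : I := clamp (Num.min (ival u) (k%:R / N.+1%:R)).
have ctk k (Z : topologicalType) (f : Z -> I) : continuous f ->
    continuous (fun x => tk k (f x)).
  move=> cf; apply: (continuousT_comp clamp_continuous).
  apply: continuousT_min; last exact: continuousT_cst.
  exact: (continuousT_comp ival_continuous cf).
have tkE k u : ival (tk k u) = Num.min (ival u) (k%:R / N.+1%:R).
  rewrite clampE//; have /andP[u0 u1] := ivalP u.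
  by rewrite le_min u0 divr_ge0//= ge_min u1.
pose c k i (x : I * B) := W i (tk k x.1, x.2).
pose Psi := fix Psi k (x : I * B) z := if k is k'.+1 then
  push d (c k' ^~ x) (c k'.+1 ^~ x) (Psi k' x z) else z.
have cc k i : continuous (fun x : (I * B) * V => c k i x.1).
  apply: (continuousT_comp (cW i)); apply: continuousT_pair.
    apply: ctk; exact: (continuousT_comp (@continuousT_fst _ _)
      (@continuousT_fst _ _)).
  exact: (continuousT_comp (@continuousT_snd _ _) (@continuousT_fst _ _)).
have ck k x : \sum_(i < n) `|c k.+1 i x - c k i x| < d.
  apply: (@le_lt_trans _ _ (\sum_(i < n) (d / n.+1%:R))).
    apply: ler_sum => i _; apply/ltW/NW; rewrite !tkE -[k.+1]addn1 natrD mulrDl.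
    rewrite mul1r; set s := N.+1%:R^-1; have s0 : 0 < s by rewrite invr_gt0.
    have [u1|u1] := leP (ival x.1) (k%:R * s + s);
      have [u2|u2] := leP (ival x.1) (k%:R * s);
      by rewrite ler_norml; apply/andP; split; lra.
  rewrite sumr_const card_ord -[ltLHS]mulr_natr -mulrA gtr_pMr//.
  by rewrite mulrC ltr_pdivrMr// mul1r ltr_nat.
exists (Psi N.+1); split.
- elim: N.+1 => [|k ih] /=; first exact: continuousT_snd.
  apply: (push_continuous (c := fun i (x : (I * B) * V) => c k i x.1)
    (c' := fun i (x : (I * B) * V) => c k.+1 i x.1)) => //.
- move=> x; elim: N.+1 => [|k ih] /=; first by [].
  apply: inj_comp ih; exact: push_inj.
- move=> u b i.
  suff PsiE k : Psi k (u, b) (W i (zero, b)) = c k i (u, b).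
    rewrite PsiE /c /= (_ : tk _ u = u)//; apply: ival_inj.
    by rewrite tkE divff// min_l//; have /andP[] := ivalP u.
  elim: k => [|k ih] /=.
    rewrite /c /= (_ : tk 0%N u = zero)//; apply: ival_inj.
    by rewrite tkE mul0r ival0 min_r//; have /andP[] := ivalP u.
  by rewrite ih push_point// => j j' jj'; exact: sepd.
- move=> u b z Wu; elim: N.+1 => [//|k ih] /=.
  rewrite ih push_id// => i; rewrite /c /= [LHS]Wu ?[RHS]Wu// tkE;
    by rewrite ge_min lexx.
Qed.
End ambient_isotopy.

(** * Strands, and [phi_ n] as the homotopy class of the first [n] of them *)

Section strands.
Context {R : realType}.
Local Notation X := (inj_plane R).
Local Notation I := (unit_interval R).
Local Notation loop := {path I from (@idX R) to (@idX R) in X}.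
Implicit Types (f g : X) (p q : loop) (n : nat).

Definition strand f i : R * R := ev f (zpt i).

Definition base i : R * R := (i.+1%:R, 0).

Lemma base_inj : injective base.
Proof.
by move=> i j /(congr1 fst)/eqP /=; rewrite eqr_nat => /eqP[].
Qed.

Lemma strand_inj f : injective (strand f).
Proof.
move=> i j /ev_inj /(congr1 (fun z => \val z)) ij; apply: base_inj; exact: ij.
Qed.

Lemma strand_eqP f g : strand f =1 strand g -> f = g.
Proof.
by move=> fg; apply: inj_plane_eqP => z; have [i ->] := zptP z; exact: fg.
Qed.

Definition zpt_index (z : Zplus R) : nat := projT1 (cid (zptP z)).

Lemma zpt_indexK i : zpt_index (zpt i) = i.
Proof.
rewrite /zpt_index; case: cid => j /= /(congr1 (fun z => \val z)) ij.
by apply: base_inj; rewrite /base; symmetry.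
Qed.

Lemma zpt_index_inj : injective zpt_index.
Proof.
move=> z w; have [i ->] := zptP z; have [j ->] := zptP w.
by rewrite !zpt_indexK => ->.
Qed.

Definition of_strands (u : nat -> R * R) (uinj : injective u) : X :=
  mkX (inj_comp uinj zpt_index_inj).

Lemma strand_of_strands u (uinj : injective u) i :
  strand (of_strands uinj) i = u i.
Proof. by rewrite /strand ev_mkX /= zpt_indexK. Qed.

Lemma strand_continuous (Z : topologicalType) (F : Z -> X) i :
  continuous F -> continuous (fun z => strand (F z) i).
Proof.
by move=> cF; exact: (continuousT_comp (@ev_continuous R (zpt i)) cF).
Qed.

Lemma continuous_strands (Z : topologicalType) (F : Z -> X) :
  (forall i, continuous (fun z => strand (F z) i)) -> continuous F.
Proof.
move=> cF; apply: inj_plane_continuous => z; have [i ->] := zptP z; exact: cF.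
Qed.

Lemma of_strands_continuous (Z : topologicalType) (u : nat -> Z -> R * R)
    (uinj : forall z, injective (u^~ z)) : (forall i, continuous (u i)) ->
  continuous (fun z => of_strands (uinj z)).
Proof.
move=> cu; apply: continuous_strands => i.
by under eq_fun do rewrite strand_of_strands; exact: cu.
Qed.

Lemma loop_of_strands (u : nat -> I -> R * R) :
  (forall i, continuous (u i)) -> (forall t, injective (u^~ t)) ->
  (forall i, u i zero = base i) -> (forall i, u i one = base i) ->
  exists p, forall t i, strand (p t) i = u i t.
Proof.
move=> cu uinj u0 u1.
have F0 : of_strands (uinj zero) = idX.
  by apply: strand_eqP => i; rewrite strand_of_strands u0.
have F1 : of_strands (uinj one) = idX.
  by apply: strand_eqP => i; rewrite strand_of_strands u1.
exists (mk_path (@of_strands_continuous _ _ uinj cu) F0 F1) => t i.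
exact: strand_of_strands.
Qed.

Lemma strand_P n f i : (i < n)%N ->
  strand (\val (P_ n f)) i = ((strand f i).1 - R_ n f, (strand f i).2).
Proof.
by move=> lt_in; rewrite /strand ev_mkX /shift_fun zpt_fst ler_nat lt_in.
Qed.

Lemma P_strands n f g : (forall i, (i < n)%N -> strand f i = strand g i) ->
  P_ n f = P_ n g.
Proof.
move=> fg; have Rfg : R_ n f = R_ n g.
  rewrite !R_Rmax /Rmax; apply: eq_big_seq => i.
  rewrite mem_iota => /andP[_ lt_in].
  by have := fg i lt_in; rewrite /strand => ->.
apply: val_inj; apply: shift_eq => z; have [i ->] := zptP z.
by rewrite zpt_fst ler_nat => /fg; rewrite /strand => ->; rewrite Rfg.
Qed.

Definition agree n p q := forall i, (i < n)%N ->
  forall t, strand (p t) i = strand (q t) i.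

(** [P_ n] only reads the first [n] strands. *)
Lemma agree_phi n p q : agree n p q ->
  phi_ n (pi1_class p) = phi_ n (pi1_class q).
Proof.
case: n => [//|n] pq; rewrite /phi_ /= /P_star !pi1_mapE; congr i_star.
congr pi1_class; apply/path_eqP => t; rewrite !map_loopE.
by apply: P_strands => i /pq.
Qed.

(** The isotopy following [W] is applied to all strands of [p]: being injective, it keeps the
    remaining strands off the prescribed ones. At both ends of the path parameter [W] is at rest, so
    the isotopy is the identity there. *)
Lemma transport n (W : 'I_n -> I * I -> R * R) p :
  (forall i, continuous (W i)) -> (forall z, injective (W^~ z)) ->
  (forall i t, W i (zero, t) = strand (p t) i) ->
  (forall i s, W i (s, zero) = base i) -> (forall i s, W i (s, one) = base i) ->
  exists H : I * I -> X,
    [/\ continuous H, (forall t, H (zero, t) = p t),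
        (forall s, H (s, zero) = idX), (forall s, H (s, one) = idX) &
        (forall i z, strand (H z) (val i) = W i z)].
Proof.
move=> cW Winj W0 Wz Wo.
have [Psi [cPsi Psi_inj PsiW Psi_id]] :=
  ambient_isotopy (@unit_interval_compact R) cW Winj.
pose u i (z : I * I) := Psi z (strand (p z.2) i).
have uinj z : injective (u^~ z) by move=> i j /Psi_inj/strand_inj.
have cu i : continuous (u i).
  apply: (continuousT_comp cPsi (f := fun z => (z, strand (p z.2) i))).
  apply: continuousT_pair; first by move=> ?.
  apply: strand_continuous.
  exact: (continuousT_comp (@cts_fun _ _ p) (@continuousT_snd _ _)).
exists (fun z => of_strands (uinj z)); split.
- exact: of_strands_continuous.
- move=> t; apply: strand_eqP => i; rewrite strand_of_strands /u Psi_id//.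
  move=> j v; rewrite ival0 => v0; congr (W _ (_, _)); apply: ival_inj.
  by apply/eqP; rewrite ival0 eq_le v0; have /andP[] := ivalP v.
- move=> s; apply: strand_eqP => i; rewrite strand_of_strands /u Psi_id/=.
    by rewrite path_zero.
  by move=> j v _; rewrite !Wz.
- move=> s; apply: strand_eqP => i; rewrite strand_of_strands /u Psi_id/=.
    by rewrite path_one.
  by move=> j v _; rewrite !Wo.
- by move=> i [s t]; rewrite strand_of_strands /u /= -W0 PsiW.
Qed.

Lemma homotopy_end (H : I * I -> X) p : continuous H ->
  (forall t, H (zero, t) = p t) -> (forall s, H (s, zero) = idX) ->
  (forall s, H (s, one) = idX) ->
  exists q, path_homotopic p q /\ forall t, q t = H (one, t).
Proof.
move=> cH H0 Hz Ho.
have c1 : continuous (fun t => H (one, t)).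
  apply: (continuousT_comp cH); apply: continuousT_pair.
    exact: continuousT_cst.
  by move=> ?.
exists (mk_path c1 (Hz one) (Ho one)); split; last by [].
by exists H; split.
Qed.

(** Converse of [agree_phi] up to homotopy. The homotopy between the retracted loops prescribes the
    first [n] strands once the shift by [R_ n] is undone, and [transport] supplies the others. *)
Lemma phi_eq_agree n p q : phi_ n (pi1_class p) = phi_ n (pi1_class q) ->
  exists p', path_homotopic p p' /\ agree n p' q.
Proof.
case: n => [_|m]; first by exists p; split; [exact: path_homotopic_refl|].
rewrite /phi_ /= /P_star (pi1_mapE _ _ p) (pi1_mapE _ _ q) /i_star !pi1_mapE.
set n := m.+1 => /pi1_classP[H [cH H0 H1 Hz Ho]].
(* Interpolates between the shifts of [p] and [q]. All strands are translated by the same amount, so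
   they stay distinct. *)
pose r (z : I * I) := (1 - ival z.1) * R_ n (p z.2) + ival z.1 * R_ n (q z.2).
pose W (i : 'I_n) z := ((strand (H z) i).1 + r z, (strand (H z) i).2).
have cR (l : loop) : continuous (fun z : I * I => R_ n (l z.2)).
  apply: (continuousT_comp (@R_continuous R n)).
  exact: (continuousT_comp (@cts_fun _ _ l) (@continuousT_snd _ _)).
have ci : continuous (fun z : I * I => ival z.1).
  exact: (continuousT_comp ival_continuous (@continuousT_fst _ _)).
have cr : continuous r.
  apply: continuousT_D; apply: continuousT_M => //.
  by apply: continuousT_B => //; exact: continuousT_cst.
have R0 (l : loop) : (R_ n (l zero) = 0) * (R_ n (l one) = 0).
  by rewrite path_zero path_one; split; apply: R_eq0; exact: X_idX.
have [||i t|i s|i s|K [cK K0 Kz Ko KW]] := @transport n W p.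
- move=> i; have cs := strand_continuous (i := i) cH.
  apply: continuousT_pair.
    apply: continuousT_D => //.
    exact: (continuousT_comp (@continuousT_fst _ _) cs).
  exact: (continuousT_comp (@continuousT_snd _ _) cs).
- move=> z i j [/addIr e1 e2]; apply: val_inj; apply: (@strand_inj (H z)).
  by apply/eqP; rewrite -pair_eqE /pair_eq e1 e2 !eqxx.
- rewrite /W H0 map_loopE map_loopE strand_P// /r /= ival0 subr0 mul1r mul0r.
  by rewrite addr0 subrK -surjective_pairing.
- by rewrite /W Hz /r /= !R0 !mulr0 !addr0.
- by rewrite /W Ho /r /= !R0 !mulr0 !addr0.
have [p' [pp' p'K]] := homotopy_end cK K0 Kz Ko.
exists p'; split => // i lt_in t; rewrite p'K (KW (Ordinal lt_in)) /W H1.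
rewrite map_loopE map_loopE strand_P// /r /= ival1 subrr mul1r mul0r.
by rewrite add0r subrK -surjective_pairing.
Qed.
End strands.

(** * Making one more strand constant *)

Section trivialize_strand.
Context {R : realType}.
Local Notation X := (inj_plane R).
Local Notation I := (unit_interval R).
Local Notation loop := {path I from (@idX R) to (@idX R) in X}.
Implicit Types (f : X) (p q : loop) (n : nat).

(** The sum bounds the displacement of each of the first [n] strands, so this point lies strictly to
    their right; it varies continuously and is [base n] when they are in base position. *)
Definition far_point n f : R * R :=
  (n.+1%:R + \sum_(i < n) `|strand f i - base i|, 0).

Lemma far_point_neq n f (i : 'I_n) : far_point n f != strand f i.
Proof.
apply/negP => /eqP/(congr1 fst)/eqP; apply/negP; rewrite gt_eqF//=.
have fi : (strand f i).1 - i.+1%:R <= `|strand f i - base i|.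
  by rewrite prod_normE (le_trans (ler_norm _))// le_max lexx.
have ni : (i.+1%:R : R) < n.+1%:R by rewrite ltr_nat ltnS ltn_ord.
rewrite (bigD1 i)//=; set S := (X in _ + (_ + X)).
have S0 : 0 <= S by apply: sumr_ge0.
lra.
Qed.

Lemma far_point_base n f : (forall i, (i < n)%N -> strand f i = base i) ->
  far_point n f = base n.
Proof.
move=> fb; rewrite /far_point big1 ?addr0// => i _.
by rewrite fb// subrr normr0.
Qed.

Lemma far_point_continuous n (Z : topologicalType) (F : Z -> X) :
  continuous F -> continuous (fun z => far_point n (F z)).
Proof.
move=> cF; apply: continuousT_pair; last exact: continuousT_cst.
apply: continuousT_D; first exact: continuousT_cst.
apply: (@continuousV_sum R R) => i; apply: continuousV_norm.
apply: continuousV_B; last exact: continuousT_cst.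
exact: strand_continuous.
Qed.

Lemma trivialize_strand n p :
  (forall i, (i < n)%N -> forall t, strand (p t) i = base i) ->
  phi_ n.+1 (pi1_class p) = 1%g ->
  exists H : I * I -> X,
    [/\ continuous H, (forall t, H (zero, t) = p t),
        (forall s, H (s, zero) = idX) /\ (forall s, H (s, one) = idX),
        (forall i, (i < n)%N -> forall z, strand (H z) i = base i) &
        (forall i, (i < n.+1)%N -> forall t, strand (H (one, t)) i = base i)].
Proof.
move=> pb; rewrite -(phi_1 n.+1) -pi1_class1 => /phi_eq_agree[p' [+ p'b]].
move=> [K [cK K0 K1 Kz Ko]].
have {}p'b i t : (i < n.+1)%N -> strand (K (one, t)) i = base i.
  by move=> i_n; rewrite K1 p'b.
(* Rises from 0 to 1 at half time and falls back: [K] is followed and then retraced. *)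
pose tau (s : I) : R := Num.min (2 * ival s) (2 - 2 * ival s).
have ctau : continuous tau.
  have c2 : continuous (fun s : I => 2 * ival s : R).
    by apply: continuousT_M; [exact: continuousT_cst|exact: ival_continuous].
  apply: continuousT_min => //.
  by apply: continuousT_B => //; exact: continuousT_cst.
have tau0 : tau zero = 0 by rewrite /tau ival0 mulr0 subr0 min_l.
have tau1 : tau one = 0 by rewrite /tau ival1 mulr1 subrr min_r.
(* The parameter [x.1] shrinks the excursion through [K] until only [p] is left, so an isotopy along
   [x.1] returns the first [n] strands to base position. *)
pose L (x : I * (I * I)) := K (clamp ((1 - ival x.1) * tau x.2.1), x.2.2).
have cL : continuous L.
  apply: (continuousT_comp cK).
  have cs : continuous (fun x : I * (I * I) => x.2).
    exact: continuousT_snd.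
  apply: continuousT_pair;
    last exact: (continuousT_comp (@continuousT_snd _ _) cs).
  apply: (continuousT_comp clamp_continuous); apply: continuousT_M.
    apply: continuousT_B; first exact: continuousT_cst.
    exact: (continuousT_comp ival_continuous (@continuousT_fst _ _)).
  exact: (continuousT_comp ctau (continuousT_comp (@continuousT_fst _ _) cs)).
have L1 z : L (one, z) = p z.2.
  by rewrite /L ival1 subrr mul0r -[clamp 0]/zero K0.
have L_tau0 u s t : tau s = 0 -> L (u, (s, t)) = p t.
  by rewrite /L /= => ->; rewrite mulr0 -[clamp 0]/zero K0.
have Lz u s : L (u, (s, zero)) = idX by rewrite /L Kz.
have Lo u s : L (u, (s, one)) = idX by rewrite /L Ko.
pose W (i : 'I_n) x := strand (L x) i.
have cW i : continuous (W i) by exact: strand_continuous.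
have Winj x : injective (W^~ x) by move=> i j /strand_inj/val_inj.
have cII := compactT_prod (@unit_interval_compact R) (@unit_interval_compact R).
have [Psi [cPsi Psi_inj PsiW Psi_id]] := ambient_isotopy cII cW Winj.
(* Strand [n] follows [K] on the way out and is replaced by [far_point] on the way back. Both agree
   at half time, where the first [n.+1] strands of [K] are in base position. *)
pose M (z : I * I) := if ival z.1 <= 2^-1 then strand (L (zero, z)) n
  else far_point n (L (zero, z)).
have cM : continuous M.
  have cL0 : continuous (fun z => L (zero, z)).
    apply: (continuousT_comp cL); apply: continuousT_pair.
      exact: continuousT_cst.
    by move=> ?.
  apply: glue_continuous.
  - exact: (continuousT_comp ival_continuous (@continuousT_fst _ _)).
  - exact: strand_continuous.
  - exact: far_point_continuous.
  move=> [s t] /= s2; rewrite /L /= ival0 subr0 mul1r.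
  rewrite (_ : tau s = 1); last by rewrite /tau s2 min_l; lra.
  rewrite -[clamp 1]/one far_point_base ?p'b// => i i_n.
  by rewrite p'b// ltnW.
(* [Psi] at [one] undoes the motion of the first [n] strands and turns [M] into [N]; by injectivity
   [N] avoids their base points. *)
pose N z := Psi (one, z) (M z).
have cN : continuous N.
  apply: (continuousT_comp cPsi (f := fun z => ((one, z), M z))).
  apply: continuousT_pair => //; apply: continuousT_pair; last by move=> ?.
  exact: continuousT_cst.
have Nb (i : 'I_n) z : N z != base i.
  rewrite -(pb i _ z.2)// -L1 -[strand (L (one, z)) i]/(W i (one, z)) -PsiW.
  apply/negP => /eqP/Psi_inj; rewrite /M /W; case: ifP => _.
    by move=> /strand_inj ni; have := ltn_ord i; rewrite -ni ltnn.
  exact/eqP/far_point_neq.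
have Mb z : (forall u, L (u, z) = idX) -> N z = base n.
  move=> Lid; rewrite /N Psi_id /M ?Lid.
    by rewrite far_point_base ?if_same.
  by move=> i v _; rewrite /W !Lid.
pose V (i : 'I_n.+1) z := if (i < n)%N then base i else N z.
have Vn (i : 'I_n.+1) : (i < n)%N = false -> i = n :> nat.
  by move=> i_n; apply/eqP; rewrite eqn_leq -ltnS ltn_ord leqNgt i_n.
have [||i t|i s|i s|H [cH H0 Hz Ho HV]] := @transport R n.+1 V p.
- by move=> i; rewrite /V; case: (i < n)%N => //; exact: continuousT_cst.
- move=> z i j; rewrite /V; case: ifP => i_n; case: ifP => j_n.
  + by move=> /base_inj/val_inj.
  + by move=> ij; have := Nb (Ordinal i_n) z; rewrite -ij eqxx.
  + by move=> ij; have := Nb (Ordinal j_n) z; rewrite ij eqxx.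
  + by move=> _; apply: val_inj; rewrite /= (Vn i)// (Vn j).
- rewrite /V; case: ifP => [i_n|i_n]; first by rewrite pb.
  rewrite (Vn i)// /N Psi_id /M /= ?ival0 ?invr_ge0 ?ler0n ?L_tau0//.
  by move=> j v _; rewrite /W !L_tau0.
- rewrite /V; case: ifP => // i_n.
  by rewrite (Vn i)// Mb.
- rewrite /V; case: ifP => // i_n.
  by rewrite (Vn i)// Mb.
exists H; split => //.
  move=> i i_n z; rewrite -[i]/(val (Ordinal (leqW i_n : (i < n.+1)%N))) HV.
  by rewrite /V /= i_n.
move=> i i_n t; rewrite -[i]/(val (Ordinal i_n)) HV /V /=; case: ifP => // i_n'.
have -> : i = n by apply/eqP; rewrite eqn_leq -ltnS i_n leqNgt i_n'.
(* At the end [tau] vanishes, so [L] is [p], [Psi] is the identity, and [far_point] of [p] is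
   [base n]. *)
rewrite /N Psi_id.
  rewrite /M ifF ?far_point_base//; first by move=> j j_n; rewrite L_tau0 ?pb.
  by rewrite /= ival1; apply/negbTE; rewrite -ltNge; lra.
by move=> j v _; rewrite /W !L_tau0.
Qed.
End trivialize_strand.

(** * Infinite concatenation and limits of loops *)

(** Used to exchange a cut-off depending on the strand for one depending on the time. *)
Lemma sum_nat_eventually0 (V : nmodType) (F : nat -> V) (a b : nat) :
  (forall n, (a <= n)%N -> F n = 0) -> (forall n, (b <= n)%N -> F n = 0) ->
  \sum_(0 <= n < a) F n = \sum_(0 <= n < b) F n.
Proof.
wlog ab : a b / (a <= b)%N => [hw Fa Fb|Fa _].
  by case/orP: (leq_total a b) => ?; [exact: hw|symmetry; exact: hw].
rewrite [RHS](@big_cat_nat _ _ _ a)//=.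
rewrite [X in _ = _ + X]big_nat_cond [X in _ = _ + X]big1 ?addr0//.
by move=> n /andP[/andP[an _] _]; exact: Fa.
Qed.

Section limits.
Context {R : realType}.
Local Notation X := (inj_plane R).
Local Notation G := (top_pi1 R).
Local Notation I := (unit_interval R).
Local Notation loop := {path I from (@idX R) to (@idX R) in X}.
Implicit Types (p q : loop).

(** All [phi_ m] are required to be trivial, not just [phi_ n.+1]: this depends on the homotopy
    class only and so survives every step. *)
Let trivialized n q : Prop :=
  (forall i, (i < n)%N -> forall t, strand (q t) i = base i) /\
  forall m, phi_ m (pi1_class q) = 1%g.

Let step_spec n q (Hq : (I * I -> X) * loop) : Prop :=
  [/\ continuous Hq.1, (forall t, Hq.1 (zero, t) = q t),
      (forall s, Hq.1 (s, zero) = idX) /\ (forall s, Hq.1 (s, one) = idX),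
      (forall i, (i < n)%N -> forall z, strand (Hq.1 z) i = base i) &
      (forall t, Hq.1 (one, t) = Hq.2 t) /\ trivialized n.+1 Hq.2].

Let step_exists n q : trivialized n q -> exists Hq, step_spec n q Hq.
Proof.
move=> [qb q1].
have [H [cH H0 [Hz Ho] Hb H1]] := trivialize_strand qb (q1 n.+1).
have [q' [qq' q'E]] := homotopy_end cH H0 Hz Ho.
exists (H, q'); split => //; split => //; split.
  by move=> i i_n t; rewrite q'E H1.
by move=> m; rewrite -(q1 m); congr phi_; apply/esym/pi1_classP.
Qed.

Let trivialization p : (forall m, phi_ m (pi1_class p) = 1%g) ->
  exists q_ : nat -> loop, exists H_ : nat -> I * I -> X,
    q_ 0%N = p /\ forall n, step_spec n (q_ n) (H_ n, q_ n.+1) /\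
      trivialized n (q_ n).
Proof.
move=> p1.
have [f fP] : {f : nat * loop -> (I * I -> X) * loop &
    forall nq, trivialized nq.1 nq.2 -> step_spec nq.1 nq.2 (f nq)}.
  apply: (@choice _ _ (fun nq Hq => trivialized nq.1 nq.2 ->
    step_spec nq.1 nq.2 Hq)) => -[n q] /=.
  (* Elsewhere [f] takes a default value, which the recursion below never meets. *)
  have [/step_exists[Hq HqP]|nt] := pselect (trivialized n q).
    by exists Hq.
  by exists (cst idX, q).
pose q_ := fix q_ n := if n is n'.+1 then (f (n', q_ n')).2 else p.
have qP n : trivialized n (q_ n).
  elim: n => [|n ih] /=; first by split.
  by have [_ _ _ _ []] := fP (n, q_ n) ih.
exists q_, (fun n => (f (n, q_ n)).1); split => // n; split => //.
by have := fP (n, q_ n) (qP n); rewrite /= -surjective_pairing.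
Qed.

(* The null-homotopy runs the n-th homotopy of [trivialization] on the time
   interval [1 - 2^-n, 1 - 2^-(n+1)]. Each strand moves in finitely many of
   them only, which turns the infinite concatenation into a finite sum. *)
Lemma phi_trivial p : (forall m, phi_ m (pi1_class p) = 1%g) ->
  pi1_class p = 1%g.
Proof.
move=> /trivialization[q_ [H_ [q0 HqP]]].
have cH n : continuous (H_ n) by have [[]] := HqP n.
have H0 n t : H_ n (zero, t) = q_ n t by have [[_ /= ->]] := HqP n.
have H1 n t : H_ n (one, t) = q_ n.+1 t.
  by have [[_ _ _ _ [/= ->]]] := HqP n.
have Hz n s : H_ n (s, zero) = idX by have [[_ _ [/= ->]]] := HqP n.
have Ho n s : H_ n (s, one) = idX by have [[_ _ [/= _ ->]]] := HqP n.
have Hb n i z : (i < n)%N -> strand (H_ n z) i = base i.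
  by move=> i_n; have [[_ _ _ /= ->]] := HqP n.
have qb n i t : (i < n)%N -> strand (q_ n t) i = base i.
  by move=> i_n; have [_ [->]] := HqP n.
(* Clock of the [n]-th homotopy: 0 up to [s = 1 - 2^-n], and 1 from [s = 1 - 2^-(n+1)] on. *)
pose a n (s : I) : I := clamp (2 - 2 ^+ n.+1 * (1 - ival s)).
have ca n : continuous (a n).
  apply: (continuousT_comp clamp_continuous).
  apply: continuousT_B; first exact: continuousT_cst.
  apply: continuousT_M; first exact: continuousT_cst.
  by apply: continuousT_B; [exact: continuousT_cst|exact: ival_continuous].
(* Increment of strand [i] during the [n]-th homotopy. It vanishes for [i < n], so the cut-off
   [i.+1] in [L] loses nothing. *)
pose D i n (z : I * I) : R * R :=
  strand (H_ n (a n z.1, z.2)) i - strand (q_ n z.2) i.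
pose L i z := strand (p z.2) i + \sum_(0 <= n < i.+1) D i n z.
have cL i : continuous (L i).
  have cp (q : loop) : continuous (fun z : I * I => strand (q z.2) i).
    apply: strand_continuous.
    exact: (continuousT_comp (@cts_fun _ _ q) (@continuousT_snd _ _)).
  apply: (@continuousV_D R (R * R)%type) => //.
  apply: continuousV_sum => n; apply: continuousV_B => //.
  apply: strand_continuous; apply: (continuousT_comp (cH n)).
  apply: continuousT_pair; last exact: continuousT_snd.
  exact: (continuousT_comp (ca n) (@continuousT_fst _ _)).
have D0 i n z : a n z.1 = zero -> D i n z = 0.
  by rewrite /D => ->; rewrite H0 subrr.
have Dbase i n z : (i.+1 <= n)%N -> D i n z = 0.
  by move=> i_n; rewrite /D Hb// qb// subrr.
(* Completed increments telescope from [p] to [q_ k]. *)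
have D1 i k z : (forall n, (n < k)%N -> a n z.1 = one) ->
    \sum_(0 <= n < k) D i n z = strand (q_ k z.2) i - strand (p z.2) i.
  move=> ak; rewrite -q0 -(telescope_sumr (fun n => strand (q_ n z.2) i))//.
  rewrite [LHS]big_nat_cond [RHS]big_nat_cond.
  by apply: eq_bigr => n /andP[/andP[_ /ak an] _]; rewrite /D an H1.
have L1 z : (forall n, a n z.1 = one) -> forall i, L i z = base i.
  by move=> az i; rewrite /L D1// addrC subrK qb.
have Lk k z : (forall n, (n < k)%N -> a n z.1 = one) ->
    (forall n, (k < n)%N -> a n z.1 = zero) ->
    forall i, L i z = strand (H_ k (a k z.1, z.2)) i.
  move=> ak1 ak0 i; rewrite /L.
  rewrite (@sum_nat_eventually0 _ (fun n => D i n z) i.+1 k.+1)//.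
  - rewrite big_nat_recr//= D1// addrA [strand (p _) _ + _]addrC subrK.
    by rewrite /D addrC subrK.
  - by move=> n; exact: Dbase.
  - by move=> n kn; rewrite D0// ak0.
have a1 n (s : I) : 2 ^+ n.+1 * (1 - ival s) <= 1 -> a n s = one.
  by move=> s1; apply: ival_inj; rewrite /a ival1 clamp_ge1//; lra.
have a0 n (s : I) : 2 <= 2 ^+ n.+1 * (1 - ival s) -> a n s = zero.
  by move=> s1; apply: ival_inj; rewrite /a ival0 clamp_le0//; lra.
(* Either a single homotopy [k] is current, earlier clocks reading 1 and later ones 0, and all
   strands come from one configuration of [H_ k]; or all clocks read 1 and the strands are in base
   position. *)
have Linj z : injective (L^~ z).
  have [[n nz]|nz] := pselect (exists n, 1 <= 2 ^+ n.+1 * (1 - ival z.1)).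
    have [k kz kmin] := ex_minnP (ex_intro (fun n =>
      1 <= 2 ^+ n.+1 * (1 - ival z.1)) n nz).
    have Lz : forall i, L i z = strand (H_ k (a k z.1, z.2)) i.
      apply: Lk => m mk.
        apply/a1/ltW; rewrite ltNge; apply/negP => /kmin; by rewrite leqNgt mk.
      apply: a0; apply: (@le_trans _ _ (2 * (2 ^+ k.+1 * (1 - ival z.1)))).
        by rewrite ler_peMr.
      rewrite mulrA -exprS ler_wpM2r//; last by rewrite ler_eXn2l ?ltr1n.
      by have /andP[_ z1] := ivalP z.1; rewrite subr_ge0.
    by move=> i j; rewrite !Lz => /strand_inj.
  have Lz : forall i, L i z = base i.
    apply: L1 => m; apply/a1/ltW; rewrite ltNge; apply/negP => mz; apply: nz.
    by exists m.
  by move=> i j; rewrite !Lz => /base_inj.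
rewrite -pi1_class1; apply/pi1_classP; exists (fun z => of_strands (Linj z)).
split.
- exact: of_strands_continuous.
- move=> t; apply: strand_eqP => i; rewrite strand_of_strands /L big1 ?addr0//.
  move=> n _; apply: D0; apply: a0 => /=.
  by rewrite ival0 subr0 mulr1 exprS ler_peMr// exprn_ege1// ler1n.
- move=> t; apply: strand_eqP => i; rewrite strand_of_strands L1// => n.
  by apply: a1; rewrite /= ival1 subrr mulr0.
- move=> s; apply: strand_eqP => i; rewrite strand_of_strands /L /= path_zero.
  by rewrite big1 ?addr0// => n _; rewrite /D /= Hz path_zero subrr.
- move=> s; apply: strand_eqP => i; rewrite strand_of_strands /L /= path_one.
  by rewrite big1 ?addr0// => n _; rewrite /D /= Ho path_one subrr.
Qed.

Lemma phi_eq (g h : G) : (forall n, phi_ n g = phi_ n h) -> g = h.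
Proof.
move=> gh; apply: divg1_eq; rewrite -(pi1_classK (g * h^-1)%g).
apply: phi_trivial => n.
by rewrite pi1_classK phi_M phi_V gh mulgV.
Qed.

(** Representatives [q_ n] of [g n] are chosen inductively, [q_ n.+1] agreeing with [q_ n] on the
    first [n] strands. Each strand stabilizes, and the limit loop realizes all [g n]. *)
Lemma phi_lift (g : nat -> G) : (forall n, phi_ n (g n.+1) = g n) ->
  exists h, forall n, phi_ n h = g n.
Proof.
move=> gS.
have gE n : phi_ n (g n) = g n by rewrite -gS phi_G//; exact: G_phi.
have [f fP] : {f : nat * loop -> loop & forall nq,
    pi1_class nq.2 = g nq.1 ->
    pi1_class (f nq) = g nq.1.+1 /\ agree nq.1 (f nq) nq.2}.
  apply: (@choice _ _ (fun nq q' => pi1_class nq.2 = g nq.1 ->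
    pi1_class q' = g nq.1.+1 /\ agree nq.1 q' nq.2)) => -[n q] /=.
  have [qg|] := pselect (pi1_class q = g n); last by exists q.
  have [|q' [/pi1_classP q'g q'q]] := @phi_eq_agree R n (repr (g n.+1)) q.
    by rewrite pi1_classK qg gS gE.
  by exists q'; rewrite -q'g pi1_classK.
pose q_ := fix q_ n := if n is n'.+1 then f (n', q_ n') else repr (g 0%N).
have qg n : pi1_class (q_ n) = g n.
  by elim: n => [|n ih] /=; [exact: pi1_classK|have [] := fP (n, q_ n) ih].
have qS n : agree n (q_ n.+1) (q_ n) by have [] := fP (n, q_ n) (qg n).
have qq n m i t : (i < n)%N -> (n <= m)%N ->
    strand (q_ m t) i = strand (q_ n t) i.
  move=> i_n /subnK <-; elim: (m - n)%N => [//|k <-].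
  by rewrite addSn qS// (leq_trans i_n)// leq_addl.
(* Strand [i] no longer changes from [q_ i.+1] on. *)
have [||||q qE] := @loop_of_strands R (fun i t => strand (q_ i.+1 t) i).
- by move=> i; apply: strand_continuous; exact: cts_fun.
- move=> t i j; rewrite -(qq i.+1 (maxn i j).+1) ?ltnS ?leq_maxl//.
  by rewrite -(qq j.+1 (maxn i j).+1) ?ltnS ?leq_maxr// => /strand_inj.
- by move=> i; rewrite path_zero.
- by move=> i; rewrite path_one.
exists (pi1_class q) => n; rewrite (_ : phi_ n _ = phi_ n (pi1_class (q_ n))).
  by rewrite qg gE.
by apply: agree_phi => i i_n t; rewrite qE -(qq i.+1 n).
Qed.
End limits.

(** * Neighbourhoods of loops and of elements of [G] *)

Lemma cvg_initial (S : choiceType) (T : topologicalType) (w : S -> T)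
    (F : set_system S) (x : S) : Filter F ->
  w @ F --> w x -> F --> (x : initial_topology w).
Proof.
move=> FF cw U [? [[W oW <-] /= Wx]] /filterS; apply; apply: cw.
exact: open_nbhs_nbhs.
Qed.

Section neighbourhoods.
Context {R : realType}.
Local Notation X := (inj_plane R).
Local Notation G := (top_pi1 R).
Local Notation I := (unit_interval R).
Local Notation loop := {path I from (@idX R) to (@idX R) in X}.
Implicit Types (p q : loop).

(** [Zplus R] is discrete, so a compact set involves finitely many strands. *)
Lemma cvg_strands (T : Type) (F : set_system T) (f : T -> X) (x : X) :
  Filter F -> (forall i, strand (f t) i @[t --> F] --> strand x i) ->
  f @ F --> x.
Proof.
move=> FF fx; apply: cvg_initial.
apply/compact_open_cvgP => K O cK oO xKO.
suff : \forall t \near F, K `<=` [set z | O (ev (f t) z)].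
  by apply: filterS => t tO _ [z Kz <-]; exact: tO.
move: cK => /compact_near_coveringP; apply => z Kz.
exists ([set z], [set t | O (ev (f t) z)]) => /=.
  split; first exact: Zplus_discrete.
  have [i zE] := zptP z; rewrite zE; apply: (fx i).
  by apply: open_nbhs_nbhs; split => //; apply: xKO; exists z; rewrite // zE.
by move=> [w t] /= [-> Ot].
Qed.

(** Loops agreeing with [p] on ever more strands converge to [p]: near any time each strand is
    eventually that of [p], which is continuous. *)
Lemma nbhs_agree p (A : set loop) : nbhs p A ->
  exists N, forall q, agree N q p -> A q.
Proof.
pose F : set_system loop := filter_from setT (fun N => [set q | agree N q p]).
have FF : Filter F.
  apply: filter_from_filter; first by exists 0%N.
  move=> m n _ _; exists (maxn m n) => // q qp.
  by split=> i i_n t; apply: qp; rewrite leq_max i_n ?orbT.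
suff Fp : F --> p by move=> /Fp[N _ NA]; exists N.
apply: cvg_initial; apply/compact_open_cvgP => K O cK oO pKO.
suff : F [set q : loop | K `<=` [set t | O (q t)]].
  by apply: filterS => q qO _ [t Kt <-]; exact: qO.
have /compact_near_coveringP nK := cK.
apply: (nK loop F (fun (q : loop) t => O (q t))) => t Kt.
suff : (fun x : I * loop => x.2 x.1) @ filter_prod (nbhs t) F --> p t.
  by apply; apply: open_nbhs_nbhs; split => //; apply: pKO; exists t.
apply: cvg_strands => i A' /= nA'.
exists ([set u | A' (strand (p u) i)], [set q | agree i.+1 q p]) => /=.
  split; last by exists i.+1.
  exact: (strand_continuous (i := i) (@cts_fun _ _ p) nA').
by move=> [u q] /= [Au qp]; rewrite qp.
Qed.

Lemma near_uniform p i (e : R) : 0 < e ->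
  nbhs p [set q : loop | forall t, `|strand (q t) i - strand (p t) i| < e].
Proof.
move=> e0; have := @unit_interval_compact R.
move=> /compact_near_coveringP cI.
suff : nbhs p [set q : loop | [set: I] `<=`
    [set t | `|strand (q t) i - strand (p t) i| < e]].
  by apply: filterS => q qp t; exact: qp.
apply: (cI loop (nbhs p)
  (fun q t => `|strand (q t) i - strand (p t) i| < e)) => t0 _.
pose d (t : I) : R := `|strand (p t) i - strand (p t0) i|.
have cp : continuous (fun t => strand (p t) i).
  exact: strand_continuous (@cts_fun _ _ p).
have cd : continuous d.
  apply: continuousV_norm; apply: continuousV_B => //.
  exact: continuousT_cst.
(* [p] sends the compact neighbourhood [K] of [t0] into [O]. If [q] does too, the strands differ on
   [K] by less than [e / 2 + e / 4]. *)
pose K := [set t | d t <= e / 4].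
pose O := [set f : X | `|strand f i - strand (p t0) i| < e / 2].
have cK : compact K.
  apply: (subclosed_compact _ (@unit_interval_compact R)) => //.
  exact: (closed_comp (fun t _ => cd t) (@closed_le R (e / 4))).
have oO : open O.
  have cn : continuous (fun f : X => `|strand f i - strand (p t0) i|).
    apply: continuousV_norm; apply: continuousV_B; last exact: continuousT_cst.
    exact: (@ev_continuous R (zpt i)).
  exact: (open_comp (fun f _ => cn f) (@open_lt R (e / 2))).
exists (K, [set q : loop | q @` K `<=` O]) => /=; first split.
- have : nbhs t0 (d @^-1` [set r | r < e / 4]).
    apply: cd; apply: open_nbhs_nbhs; split; first exact: open_lt.
    by rewrite /= /d subrr normr0 divr_gt0.
  by apply: filterS => t /ltW.
- have nO : nbhs (p : {compact-open, I -> X}) [set g | g @` K `<=` O].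
    apply: open_nbhs_nbhs; split; first exact: compact_open_open.
    by move=> _ [t Kt <-]; rewrite /O /=; move: Kt; rewrite /K /d /=; lra.
  exact: (@initial_continuous loop {compact-open, I -> X} (fun q => q) p _ nO).
move=> [t q] /= [Kt qKO].
apply: (le_lt_trans (ler_distD (strand (p t0) i) _ _)).
have := qKO (q t) (imageP _ Kt); rewrite /O /=.
by move: Kt; rewrite /K /d /= (distrC (strand (p t0) i) (strand (p t) i)); lra.
Qed.

(** If the first [n] strands of [p] are [d] apart, moving each by less than [d / 2] keeps them
    distinct along the straight-line homotopy, which [transport] extends to all strands. *)
Lemma phi_locally_constant p n :
  nbhs p [set q : loop | phi_ n (pi1_class q) = phi_ n (pi1_class p)].
Proof.
have [||d d0 pd] := @separation_bound R (R * R)%type n I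
  (fun i t => strand (p t) i) (@unit_interval_compact R).
- by move=> i; apply: strand_continuous; exact: cts_fun.
- by move=> t i j /strand_inj/val_inj.
have : nbhs p [set q : loop | forall (i : 'I_n) t,
    `|strand (q t) i - strand (p t) i| < d / 2].
  apply: (@filter_forall loop 'I_n (fun i => [set q | forall t,
    `|strand (q t) i - strand (p t) i| < d / 2]) (nbhs p)) => i.
  by apply: near_uniform; rewrite divr_gt0.
apply: filterS => q qp.
pose W (i : 'I_n) (z : I * I) : R * R :=
  strand (p z.2) i + ival z.1 *: (strand (q z.2) i - strand (p z.2) i).
have cs (l : loop) (i : 'I_n) : continuous (fun z : I * I => strand (l z.2) i).
  apply: strand_continuous.
  exact: (continuousT_comp (@cts_fun _ _ l) (@continuousT_snd _ _)).
have [||i t|i s|i s|H [cH H0 Hz Ho HW]] := @transport R n W p.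
- move=> i; apply: continuousV_D => // z.
  apply: cvgZ; last exact: (continuousV_B (cs q i) (cs p i)).
  exact: (continuousT_comp ival_continuous (@continuousT_fst _ _)).
- move=> [s t] i j; rewrite /W /= => Wij; apply: contrapT => /eqP ij.
  have sW : strand (p t) i - strand (p t) j =
      ival s *: (strand (q t) j - strand (p t) j) -
      ival s *: (strand (q t) i - strand (p t) i).
    apply/eqP; rewrite subr_eq addrAC eq_sym subr_eq addrC -Wij.
    by rewrite eqxx.
  have := pd t i j ij; rewrite sW; apply/negP; rewrite -ltNge.
  apply: (le_lt_trans (ler_normB _ _)); rewrite !normrZ.
  have /andP[s0 s1] := ivalP s; rewrite (ger0_norm s0).
  have le1 (r : R) : 0 <= r -> ival s * r <= r by move=> r0; rewrite ler_piMl.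
  have := le1 _ (normr_ge0 (strand (q t) j - strand (p t) j)).
  have := le1 _ (normr_ge0 (strand (q t) i - strand (p t) i)).
  by have := qp i t; have := qp j t; lra.
- by rewrite /W /= ival0 scale0r addr0.
- by rewrite /W /= !path_zero subrr scaler0 addr0.
- by rewrite /W /= !path_one subrr scaler0 addr0.
have [q' [/pi1_classP -> q'E]] := homotopy_end cH H0 Hz Ho.
apply: agree_phi => i i_n t; rewrite q'E (HW (Ordinal i_n)) /W /= ival1 scale1r.
by rewrite addrC subrK.
Qed.

(** Pulled back to loops, a neighbourhood contains all loops sharing [N] strands with a
    representative of [x], and [phi_eq_agree] finds one in every class with the same [phi_ N].
    Conversely the fibres of [phi_ N] are open, since openness in the quotient is tested on
    loops. *)
Lemma nbhs_pi1 (x : G) (A : set G) :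
  nbhs x A <-> exists N, [set y | phi_ N y = phi_ N x] `<=` A.
Proof.
split.
  rewrite nbhsE => -[U [oU Ux] UA].
  have : nbhs (repr x) (@pi1_class R X idX @^-1` U).
    apply: open_nbhs_nbhs; split; first exact: oU.
    by rewrite /= pi1_classK.
  move=> /nbhs_agree[N NU]; exists N => y /= yx; apply: UA.
  have [|q [/pi1_classP yq /NU]] := @phi_eq_agree R N (repr y) (repr x).
    by rewrite !pi1_classK.
  by rewrite /= -yq pi1_classK.
move=> [N NA]; apply: filterS NA _; apply: open_nbhs_nbhs; split => //.
rewrite /open /= /quotient_open openE => p /= px.
by apply: filterS (phi_locally_constant p N) => q /= qp; exact: etrans qp px.
Qed.
End neighbourhoods.

(** * Ultrametrics from decreasing equivalence relations *)

Section ultrametric.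
Context {R : realType} {T : Type} (E : nat -> T -> T -> Prop).
Hypotheses (E_refl : forall n x, E n x x)
  (E_sym : forall n x y, E n x y -> E n y x)
  (E_trans : forall n x y z, E n x y -> E n y z -> E n x z)
  (E_leq : forall m n x y, (m <= n)%N -> E n x y -> E m x y).

(** This is [2 ^- n] for the least [n] separating [x] and [y]; the added 0 keeps the set nonempty
    when nothing separates them. *)
Definition udist (x y : T) : R :=
  sup [set r | r = 0 \/ exists2 n, ~ E n x y & r = 2 ^- n].

Lemma udist_le x y (r : R) : 0 <= r ->
  (forall n, ~ E n x y -> 2 ^- n <= r) -> udist x y <= r.
Proof.
move=> r0 rE; apply: ge_sup; first by exists 0; left.
by move=> _ [->//|[n nE ->]]; exact: rE.
Qed.

Lemma udist_bounded x y :
  has_ubound [set r : R | r = 0 \/ exists2 n, ~ E n x y & r = 2 ^- n].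
Proof.
exists 1 => _ [->|[n _ ->]]; first exact: ler01.
by rewrite invf_le1 ?exprn_gt0// exprn_ege1// ler1n.
Qed.

Lemma udist_ge0 x y : 0 <= udist x y.
Proof. by apply: ub_le_sup; [exact: udist_bounded|left]. Qed.

(** Failure of [E n] gives distance at least [2 ^- n]. Otherwise only larger indices separate, and
    the distance is at most [2 ^- n.+1]. *)
Lemma udist_lt x y n : udist x y < 2 ^- n <-> E n x y.
Proof.
split=> [xy|nE].
  apply: contrapT => nE; move: xy; apply/negP; rewrite -leNgt.
  by apply: ub_le_sup; [exact: udist_bounded|right; exists n].
apply: (@le_lt_trans _ _ (2 ^- n.+1)).
  apply: udist_le => [|m mE]; first by rewrite invr_ge0 exprn_ge0.
  rewrite lef_pV2 ?posrE ?exprn_gt0// ler_eXn2l ?ltr1n// ltnNge.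
  by apply/negP => mn; apply: mE; exact: E_leq nE.
by rewrite ltf_pV2 ?posrE ?exprn_gt0// ltr_eXn2l ?ltr1n.
Qed.

Lemma expVn_lt (e : R) : 0 < e -> exists n, 2 ^- n < e.
Proof.
move=> e0.
have [n _ /(_ n (leqnn n)) ne] := near_infty_natSinv_expn_lt (PosNum e0).
by exists n; rewrite /= div1r in ne.
Qed.

Lemma udist_metric : (forall x y, (forall n, E n x y) -> x = y) ->
  is_metric udist.
Proof.
have sym x y : udist x y <= udist y x.
  apply: udist_le; first exact: udist_ge0.
  move=> n nE; rewrite leNgt; apply/negP => /udist_lt/E_sym; exact: nE.
move=> E_eq; split.
- exact: udist_ge0.
- move=> x y; split=> [xy0|->].
    apply: E_eq => n; apply/udist_lt; rewrite xy0.
    by rewrite invr_gt0 exprn_gt0.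
  by apply/eqP; rewrite eq_le udist_ge0 andbT; apply: udist_le => // n [].
- by move=> x y; apply/eqP; rewrite eq_le !sym.
- move=> x y z; apply: udist_le; first by rewrite addr_ge0 ?udist_ge0.
  move=> n nE; have [xy|xy] := pselect (E n x y); last first.
    rewrite (@le_trans _ _ (udist x y))// ?lerDl ?udist_ge0//.
    by rewrite leNgt; apply/negP => /udist_lt.
  rewrite (@le_trans _ _ (udist y z))// ?lerDr ?udist_ge0//.
  rewrite leNgt; apply/negP => /udist_lt yz; apply: nE; exact: E_trans yz.
Qed.

(** For each [n] a Cauchy sequence stays in one class of [E n] from some index [N n] on, and the
    terms [u (N n)] form a compatible sequence. *)
Lemma udist_complete :
  (forall g : nat -> T, (forall n, E n (g n.+1) (g n)) ->
    exists h, forall n, E n h (g n)) ->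
  metric_complete udist.
Proof.
move=> E_lim u cu.
have /choice[N NE] n : exists N, forall m, (N <= m)%N -> E n (u m) (u N).
  have [|N uN] := cu (2 ^- n); first by rewrite invr_gt0 exprn_gt0.
  by exists N => m Nm; apply/udist_lt; exact: uN.
have [|h hE] := E_lim (u \o N).
  (* Both terms are compared with the one at [maxn (N n) (N n.+1)]. *)
  move=> n /=; have := NE n _ (leq_maxl (N n) (N n.+1)).
  apply: E_trans; apply: E_sym; apply: (E_leq (leqnSn n)).
  by apply: NE; exact: leq_maxr.
exists h => e /expVn_lt[n ne]; exists (N n) => m nm.
apply: lt_trans ne; apply/udist_lt; apply: (E_trans (hE n)).
by apply: E_sym; exact: NE.
Qed.
End ultrametric.

(** * The homeomorphism and the complete metric *)

Section phi_homeomorphism.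
Context {R : realType}.
Local Notation G := (top_pi1 R).
Local Notation Pi := (twisted_product R).

Lemma phi_phi m n (x : G) : (m <= n)%N -> phi_ m (phi_ n x) = phi_ m x.
Proof.
move=> /subnK <-; elim: (n - m)%N x => [|k ih] x; first exact/phi_G/G_phi.
by rewrite addSn -ih phi_phiS ih.
Qed.

Lemma phi_eq_leq m n (x y : G) : (m <= n)%N -> phi_ n x = phi_ n y ->
  phi_ m x = phi_ m y.
Proof. by move=> mn xy; rewrite -(phi_phi _ mn) xy phi_phi. Qed.

(** The partial products are compatible because [component y n] lies in the kernel of [phi_ n]. *)
Lemma phi_preimage (y : Pi) :
  exists h, forall n, phi_ n h = partial_product y n.
Proof.
apply: phi_lift => n; rewrite partial_productS phi_M.
rewrite (phi_G (partial_product_G _ _)).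
by have [_ /= ->] := componentP y n; rewrite mulg1.
Qed.

Lemma near_component (y : Pi) n : nbhs y [set z : Pi | z n = y n].
Proof.
apply: (@proj_continuous nat
  (fun n => discrete_topology (@K_ R n.+1)) n y [set u | u = y n]).
by rewrite nbhs_principalE; exact/principal_filterP.
Qed.

(** Coordinate [n] is built from [phi_ n] and [phi_ n.+1], and the latter determines the former. *)
Lemma phi_continuous : continuous (@phi R).
Proof.
move=> x; have FF : Filter (@phi R @ x) by exact/fmap_filter/nbhs_filter.
apply/cvg_sup => n; apply: cvg_initial => A /nbhs_singleton Ax.
apply/nbhs_pi1; exists n.+1 => y /= yx.
rewrite /= (_ : phi y n = phi x n)//; apply: val_inj => /=.
by rewrite yx (phi_eq_leq (leqnSn n) yx).
Qed.

Lemma phi_homeomorphism : homeomorphism (@phi R).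
Proof.
have /choice[psi psiE] := phi_preimage.
have psiK : cancel psi (@phi R).
  by move=> y; apply: partial_product_inj => n; rewrite phi_partial_product.
have phiK : cancel (@phi R) psi.
  by move=> x; apply: phi_eq => n; rewrite psiE phi_partial_product.
exists psi; split => //; first exact: phi_continuous.
move=> y A /nbhs_pi1[N NA].
(* [phi_ N] of the preimage is the product of the first [N] coordinates. *)
have : nbhs y [set z : Pi | forall n : 'I_N, z n = y n].
  apply: (@filter_forall Pi 'I_N (fun n => [set z | z n = y n]) (nbhs y)) => n.
  exact: near_component.
apply: filterS => z zy; apply: NA; rewrite /= !psiE.
by apply: eq_bigr => n _; rewrite /component zy.
Qed.

Lemma pi1_topologically_complete : topologically_complete R G.
Proof.
pose E n (x y : G) := phi_ n x = phi_ n y.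
have E_trans n x y z : E n x y -> E n y z -> E n x z by exact: etrans.
have E_leq m n x y : (m <= n)%N -> E n x y -> E m x y by exact: phi_eq_leq.
have E_sym n x y : E n x y -> E n y x by exact: esym.
exists (udist E); split.
- by apply: udist_metric => // x y; exact: phi_eq.
- apply: udist_complete => // g gE.
  (* The [g n] are compatible only after [phi_ n]; [phi_lift] needs equality, which passing to
     [phi_ n (g n)] ensures. *)
  have [|h hE] := @phi_lift R (fun n => phi_ n (g n)).
    by move=> n; rewrite phi_phi// gE.
  by exists h.
- move=> x A; rewrite nbhs_pi1; split=> [[N NA]|[e e0 eA]].
    exists (2 ^- N); first by rewrite invr_gt0 exprn_gt0.
    by move=> y /udist_lt yx; apply: NA; exact/esym/yx.
  have [N Ne] := expVn_lt e0; exists N => y yx; apply: eA => /=.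
  by apply: lt_trans Ne; apply/udist_lt => //; exact: esym.
Qed.
End phi_homeomorphism.

Theorem theorem20 (R : realType) :
  homeomorphism (@phi R) /\ topologically_complete R (top_pi1 R).
Proof.
by split; [exact: phi_homeomorphism|exact: pi1_topologically_complete].
Qed.
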